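(* Let $\mathfrak{g} = \mathfrak{sl}_n(\mathbb{C})$, $n\ge 2$, $\mu = (n-1,1)$ and $\lambda = (n)$, so that in the construction described in the context $e_1$ is a subregular nilpotent and $e_2$ is a regular nilpotent. Then the reduction by stages $U(\mathfrak{g},e_1) /\!/\!/_\kappa\, \mathfrak{k} \simeq U(\mathfrak{g}) /\!/\!/_{\chi_2} \mathfrak{m}_2$ is isomorphic to the W-algebra $U(\mathfrak{g},e_2)$.
   Context: Quantum Hamiltonian reduction. For a nilpotent subalgebra $\mathfrak{m}\subseteq\mathfrak{g}$ and $\chi \in \mathfrak{g}^*$ restricting to a character of $\mathfrak{m}$, put $\mathfrak{m}_\chi = \{y - \chi(y) : y \in \mathfrak{m}\} \subseteq U(\mathfrak{g})$ and $$U(\mathfrak{g}) /\!/\!/_\chi \mathfrak{m} := \bigl(U(\mathfrak{g})/U(\mathfrak{g})\mathfrak{m}_\chi\bigr)^{\mathfrak{m}} = \{\bar u : [a,u] \in U(\mathfrak{g})\mathfrak{m}_\chi \ \forall a \in \mathfrak{m}\},$$ an algebra with product induced from $U(\mathfrak{g})$. W-algebra. A $\mathbb{Z}$-grading of $\mathfrak{g}$ is good for a nilpotent $e$ if $e \in \mathfrak{g}_2$, $\mathrm{ad}\, e\colon \mathfrak{g}_d \to \mathfrak{g}_{d+2}$ is injective for $d \le -1$ and surjective for $d \ge -1$. Given a good grading and a Lagrangian subspace $\mathfrak{l} \subseteq \mathfrak{g}_{-1}$ for the form $\omega(x,y) = \langle e,[x,y]\rangle$ ($\langle\cdot,\cdot\rangle$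 the Killing form), the Premet subalgebra is $\mathfrak{m} = \mathfrak{l}\oplus\bigoplus_{d\le -2}\mathfrak{g}_d$, and the W-algebra is $U(\mathfrak{g},e) := U(\mathfrak{g})/\!/\!/_\chi \mathfrak{m}$ with $\chi = \langle e,\cdot\rangle$. Up to isomorphism it depends only on the nilpotent orbit of $e$. Construction. Partitions are padded with zeros. Let $\lambda$ cover $\mu$ in the dominance ordering of partitions of $n$; then there are indices $i<j$ with $\lambda_i = \mu_i+1$, $\lambda_j = \mu_j - 1$ and $\lambda_s = \mu_s$ otherwise (for $\mu=(n-1,1)$, $\lambda=(n)$ one has $i=1$, $j=2$). Take the right-aligned pyramid of shape $\mu$: rows are numbered from the bottom, row $r$ consists of $\mu_r$ consecutive boxes, all rows have their rightmost box in the same column, and horizontally adjacent boxes have column coordinates differing by $2$ (increasing to the right). Label the boxes $1,\dots,n$ from bottom to top within each column, columns being taken from left to right. Let $\mathrm{row}(k)$, $\mathrm{col}(k)$ be the row and column of box $k$; write $k \to \ell$ if $\mathrm{row}(k) = \mathrm{row}(\ell)$ and $\mathrm{col}(\ell) = \mathrm{col}(k)+2$. Let $E_{k\ell}$ be the matrix units. Set $e_1 = \sum_{k\to\ell} E_{k\ell}$ (nilpotent of type $\mu$), grade $\mathfrak{g}$ by $\deg E_{k\ell} = \mathrm{col}(\ell) - \mathrm{col}(k)$ (an even good grading for $e_1$), and let $\mathfrak{m}_1 = \bigoplus_{d \le -2} \mathfrak{g}_d$. Define $$e_2 = e_1 + \sum_{\substack{\mathrm{row}(k)=i,\ \mathrm{row}(\ell)=j\\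 \mathrm{col}(k)=\mathrm{col}(\ell)}} E_{k\ell}, \qquad E_m = \sum_{\substack{i \le \mathrm{row}(k) < \mathrm{row}(\ell) \le j\\ \mathrm{row}(\ell)-\mathrm{row}(k) = m\\ \mathrm{col}(k)=\mathrm{col}(\ell)}} E_{\ell k}\quad (1 \le m \le j-i),$$ $\mathfrak{k} = \langle E_m \rangle_{m=1}^{j-i}$ and $\mathfrak{m}_2 = \mathfrak{m}_1 + \mathfrak{k}$. Then $e_2$ is nilpotent of type $\lambda$ and $\mathfrak{m}_2 = \mathfrak{m}_1\rtimes\mathfrak{k}$. Let $\chi_a = \langle e_a, \cdot\rangle \in \mathfrak{g}^*$ for $a=1,2$, and $\kappa = \chi_2|_{\mathfrak{k}}$; $\chi_2$ restricts to a character of $\mathfrak{m}_2$. With $U(\mathfrak{g},e_1) = U(\mathfrak{g})/\!/\!/_{\chi_1}\mathfrak{m}_1$, the Lie algebra $\mathfrak{k}$ acts on it by the adjoint action, with comoment map sending $y\in\mathfrak{k}$ to its class $\bar y$; with $\mathfrak{k}_\kappa = \{\bar y - \kappa(y) : y \in \mathfrak{k}\}$ one sets $U(\mathfrak{g},e_1)/\!/\!/_\kappa \mathfrak{k} := (U(\mathfrak{g},e_1)/U(\mathfrak{g},e_1)\mathfrak{k}_\kappa)^{\mathfrak{k}}$. The isomorphism $U(\mathfrak{g},e_1) /\!/\!/_\kappa \mathfrak{k} \simeq U(\mathfrak{g}) /\!/\!/_{\chi_2} \mathfrak{m}_2$ is the one induced by the identity on representatives. *)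

(* Defs.v *)
From HB Require Import structures.
From mathcomp Require Import all_boot all_order all_algebra.
From mathcomp Require Import boolp reals complex.
From mathcomp Require Import monalg ring.

Set Implicit Arguments.
Unset Strict Implicit.
Unset Printing Implicit Defensive.

Import Order.TTheory GRing.Theory Num.Theory.
Local Open Scope ring_scope.
Local Open Scope quotient_scope.

(* ======================== Associative algebras ========================== *)

(* MathComp's algType requires 1 != 0, which a total construction of quotient
   algebras cannot guarantee. Here a K-algebra is a possibly zero ring with a
   morphism from K to its centre; the scalar multiple of x by c is
   algc c * x. *)
HB.mixin Record PzRing_isAlgebra (K : comNzRingType) A of GRing.PzRing A := {
  algc : {rmorphism K -> A};
  algc_central : forall (c : K) (x : A), algc c * x = x * algc c
}.

#[short(type="pzAlgType")]
HB.structure Definition PzAlgebra (K : comNzRingType) :=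
  {A of GRing.PzRing A & PzRing_isAlgebra K A}.

Definition alg_iso (K : comNzRingType) (A B : pzAlgType K)
    (f : {rmorphism A -> B}) : Prop :=
  (forall c : K, f (algc c) = algc c) /\ bijective f.

Definition alg_isomorphic (K : comNzRingType) (A B : pzAlgType K) : Prop :=
  exists f : {rmorphism A -> B}, alg_iso f.

Record ideal (A : pzRingType) := Ideal {
  ideal_mem :> A -> Prop;
  ideal0 : ideal_mem 0;
  idealD : forall x y, ideal_mem x -> ideal_mem y -> ideal_mem (x + y);
  idealMl : forall a x, ideal_mem x -> ideal_mem (a * x);
  idealMr : forall a x, ideal_mem x -> ideal_mem (x * a)
}.

Section IdealQuotient.
Variables (K : comNzRingType) (A : pzAlgType K) (J : ideal A).

Lemma idealN x : J x -> J (- x).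
Proof. by rewrite -mulN1r; apply: idealMl. Qed.

Lemma idealB x y : J x -> J y -> J (x - y).
Proof. by move=> Jx Jy; apply/idealD/idealN. Qed.

Definition ideal_equiv : rel A := fun x y => `[< J (x - y) >].

Lemma ideal_equiv_is_equiv : equiv_class_of ideal_equiv.
Proof.
split=> [x|x y|y x z].
- by apply/asboolP; rewrite subrr; apply: ideal0.
- by apply/asboolP/asboolP=> /idealN; rewrite opprB.
- by move=> /asboolP Jxy /asboolP Jyz; apply/asboolP;
    rewrite -(subrKA y); apply: idealD.
Qed.

Canonical ideal_equiv_equiv := EquivRelPack ideal_equiv_is_equiv.

Definition quot := {eq_quot ideal_equiv}.
HB.instance Definition _ : EqQuotient A ideal_equiv quot := EqQuotient.on quot.
HB.instance Definition _ := Choice.on quot.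

Definition qproj (x : A) : quot := \pi_quot x.

Lemma qprojP x y : qproj x = qproj y <-> J (x - y).
Proof.
split=> [/eqmodP|Jxy]; first by move/asboolP.
by apply/eqmodP/asboolP.
Qed.

Lemma qproj_repr (q : quot) : qproj (repr q) = q.
Proof. by rewrite /qproj reprK. Qed.

Lemma quot_ind (P : quot -> Prop) : (forall x, P (qproj x)) -> forall q, P q.
Proof. by move=> Px q; rewrite -[q]qproj_repr. Qed.

Lemma repr_qproj x : J (repr (qproj x) - x).
Proof. by apply/qprojP; rewrite qproj_repr. Qed.

Definition quot_add (p q : quot) := qproj (repr p + repr q).
Definition quot_opp (p : quot) := qproj (- repr p).
Definition quot_mul (p q : quot) := qproj (repr p * repr q).

Lemma quot_addE x y : quot_add (qproj x) (qproj y) = qproj (x + y).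
Proof.
by apply/qprojP; rewrite opprD addrACA; apply/idealD; apply: repr_qproj.
Qed.

Lemma quot_oppE x : quot_opp (qproj x) = qproj (- x).
Proof. by apply/qprojP; rewrite -opprD; apply/idealN; apply: repr_qproj. Qed.

Lemma quot_mulE x y : quot_mul (qproj x) (qproj y) = qproj (x * y).
Proof.
apply/qprojP; rewrite -(subrKA (repr (qproj x) * y)) -mulrBr -mulrBl.
by apply: idealD; [apply: idealMl|apply: idealMr]; apply: repr_qproj.
Qed.

Let E := (quot_addE, quot_oppE, quot_mulE).

Fact quot_addA : associative quot_add.
Proof. by do 3!elim/quot_ind=> ?; rewrite !E addrA. Qed.
Fact quot_addC : commutative quot_add.
Proof. by do 2!elim/quot_ind=> ?; rewrite !E addrC. Qed.
Fact quot_add0 : left_id (qproj 0) quot_add.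
Proof. by elim/quot_ind=> ?; rewrite !E add0r. Qed.
Fact quot_addN : left_inverse (qproj 0) quot_opp quot_add.
Proof. by elim/quot_ind=> ?; rewrite !E addNr. Qed.

HB.instance Definition _ :=
  GRing.isZmodule.Build quot quot_addA quot_addC quot_add0 quot_addN.

Fact quot_mulA : associative quot_mul.
Proof. by do 3!elim/quot_ind=> ?; rewrite !E mulrA. Qed.
Fact quot_mul1 : left_id (qproj 1) quot_mul.
Proof. by elim/quot_ind=> ?; rewrite !E mul1r. Qed.
Fact quot_mulr1 : right_id (qproj 1) quot_mul.
Proof. by elim/quot_ind=> ?; rewrite !E mulr1. Qed.
Fact quot_mulDl : left_distributive quot_mul quot_add.
Proof. by do 3!elim/quot_ind=> ?; rewrite !E mulrDl. Qed.
Fact quot_mulDr : right_distributive quot_mul quot_add.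
Proof. by do 3!elim/quot_ind=> ?; rewrite !E mulrDr. Qed.

HB.instance Definition _ := GRing.Zmodule_isPzRing.Build quot
  quot_mulA quot_mul1 quot_mulr1 quot_mulDl quot_mulDr.

Fact qproj_is_zmod_morphism : zmod_morphism qproj.
Proof. by move=> x y; rewrite -quot_addE -quot_oppE. Qed.
Fact qproj_is_monoid_morphism : monoid_morphism qproj.
Proof. by split=> // x y; rewrite -quot_mulE. Qed.

HB.instance Definition _ :=
  GRing.isZmodMorphism.Build A quot qproj qproj_is_zmod_morphism.
HB.instance Definition _ :=
  GRing.isMonoidMorphism.Build A quot qproj qproj_is_monoid_morphism.

Definition quot_algc : {rmorphism K -> quot} := qproj \o algc.

Fact quot_algc_central c (q : quot) : quot_algc c * q = q * quot_algc c.
Proof.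
by elim/quot_ind: q => x; rewrite /quot_algc /= -!rmorphM algc_central.
Qed.

HB.instance Definition _ := PzRing_isAlgebra.Build K quot quot_algc_central.

End IdealQuotient.

Section GeneratedIdeal.
Variables (A : pzRingType) (S : A -> Prop).

Definition gen_ideal_mem (x : A) : Prop :=
  forall J : ideal A, (forall s, S s -> J s) -> J x.

Fact gen_ideal0 : gen_ideal_mem 0.
Proof. by move=> J _; apply: ideal0. Qed.
Fact gen_idealD x y : gen_ideal_mem x -> gen_ideal_mem y -> gen_ideal_mem (x + y).
Proof. by move=> Sx Sy J SJ; apply: idealD; [apply: Sx|apply: Sy]. Qed.
Fact gen_idealMl a x : gen_ideal_mem x -> gen_ideal_mem (a * x).
Proof. by move=> Sx J SJ; apply/idealMl/Sx. Qed.
Fact gen_idealMr a x : gen_ideal_mem x -> gen_ideal_mem (x * a).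
Proof. by move=> Sx J SJ; apply/idealMr/Sx. Qed.

Definition gen_ideal : ideal A :=
  Ideal gen_ideal0 gen_idealD gen_idealMl gen_idealMr.

End GeneratedIdeal.

(* ============================= Lie algebras ============================= *)

HB.mixin Record Vector_isLie (K : fieldType) g of Vector K g := {
  bracket : g -> g -> g;
  bracketPl : forall y, linear (bracket^~ y);
  bracketPr : forall x, linear (bracket x);
  bracketxx : forall x, bracket x x = 0;
  jacobi : forall x y z,
    bracket x (bracket y z) + bracket y (bracket z x)
      + bracket z (bracket x y) = 0
}.

#[short(type="lieAlgType")]
HB.structure Definition LieAlgebra (K : fieldType) :=
  {g of Vector K g & Vector_isLie K g}.

Section KillingForm.
Variables (K : fieldType) (g : lieAlgType K).

Definition ad (x : g) : 'End(g) := linfun (bracket x).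

Definition lfun_trace (f : 'End(g)) : K :=
  \tr (passmx.mxof (vbasis {:g}) (vbasis {:g}) f).

Definition killing (x y : g) : K := lfun_trace (ad x \o ad y)%VF.

End KillingForm.

(* ===================== Universal enveloping algebra ===================== *)

Section FreeAlgebra.
Variables (K : comNzRingType) (T : choiceType).

Definition free_alg := {malg K[{fmonom T}]}.
HB.instance Definition _ := GRing.PzRing.on free_alg.

Definition free_algc : {rmorphism K -> free_alg} := @malgC {fmonom T} K.

Fact free_algc_central c (x : free_alg) : free_algc c * x = x * free_algc c.
Proof.
rewrite mul_malgC malgM_def fgmulgU malgZ_def.
by apply: eq_bigr => k _; rewrite mulm1 mulrC.
Qed.

HB.instance Definition _ := PzRing_isAlgebra.Build K free_alg free_algc_central.

Definition free_gen (t : T) : free_alg := mkmalgU (fmu t) 1.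

End FreeAlgebra.

Section EnvelopingAlgebra.
Variables (K : fieldType) (g : lieAlgType K).

(* The free algebra on the set g modulo the first two families of relations
   is the tensor algebra of the vector space g. *)
Inductive uea_rel : free_alg K g -> Prop :=
| UeaAdd x y : uea_rel (free_gen K (x + y) - (free_gen K x + free_gen K y))
| UeaScale c x : uea_rel (free_gen K (c *: x) - algc c * free_gen K x)
| UeaBracket x y : uea_rel (free_gen K x * free_gen K y
    - free_gen K y * free_gen K x - free_gen K (bracket x y)).

Definition uea := quot (gen_ideal uea_rel).
HB.instance Definition _ := PzAlgebra.on uea.

Definition uea_in (x : g) : uea := qproj (gen_ideal uea_rel) (free_gen K x).

End EnvelopingAlgebra.

(* ==================== Quantum Hamiltonian reduction ===================== *)

Section Reduction.
Variables (K : fieldType) (V : vectType K) (A : pzAlgType K).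
Variables (m : {vspace V}) (f : V -> A) (chi : V -> K).

(* The reduction of A by m along the comoment map f : m -> A at the
   character chi. The functions f and chi are only used on m. *)

Definition shift (y : V) : A := f y - algc (chi y).

Definition shift_ideal (x : A) : Prop :=
  exists s : seq (A * V), all (fun p => p.2 \in m) s /\
    x = \sum_(p <- s) p.1 * shift p.2.

Definition invariant (u : A) : Prop :=
  forall a, a \in m -> shift_ideal (f a * u - u * f a).

Definition inv_pred : pred A := fun u => `[< invariant u >].

Lemma shift_ideal0 : shift_ideal 0.
Proof. by exists [::]; rewrite big_nil. Qed.

Lemma shift_idealD x y : shift_ideal x -> shift_ideal y -> shift_ideal (x + y).
Proof.
move=> [s [sm ->]] [t [tm ->]]; exists (s ++ t).
by rewrite all_cat sm tm big_cat.
Qed.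

Lemma shift_idealMl a x : shift_ideal x -> shift_ideal (a * x).
Proof.
move=> [s [sm ->]]; exists [seq (a * p.1, p.2) | p <- s]; split.
  by rewrite all_map.
by rewrite big_map mulr_sumr; apply: eq_bigr => p _; rewrite mulrA.
Qed.

Lemma shift_idealN x : shift_ideal x -> shift_ideal (- x).
Proof. by rewrite -mulN1r; apply: shift_idealMl. Qed.

Lemma shift_idealMr u x : invariant u -> shift_ideal x -> shift_ideal (x * u).
Proof.
move=> uN [s [sm ->]]; rewrite mulr_suml big_seq.
apply: (big_ind shift_ideal) => [||p ps].
- exact: shift_ideal0.
- exact: shift_idealD.
have pm := allP sm p ps; rewrite -mulrA; apply: shift_idealMl.
rewrite mulrBl algc_central -(subrKA (u * f p.2)) -mulrBr.
apply: shift_idealD; first exact: uN.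
by apply: shift_idealMl; exists [:: (1, p.2)]; rewrite /= pm big_seq1 mul1r.
Qed.

Fact inv_subring : subring_closed inv_pred.
Proof.
split=> [|u v /asboolP uN /asboolP vN|u v /asboolP uN /asboolP vN];
  apply/asboolP=> a am.
- by rewrite mulr1 mul1r subrr; apply: shift_ideal0.
- rewrite mulrBr mulrBl.
  have -> : f a * u - f a * v - (u * f a - v * f a)
          = (f a * u - u * f a) - (f a * v - v * f a).
    by rewrite !opprD !opprK addrACA.
  by apply: shift_idealD; [exact: uN|apply: shift_idealN; exact: vN].
- rewrite mulrA -(subrKA (u * f a * v)) -mulrBl -!mulrA -mulrBr.
  by apply: shift_idealD; [apply: shift_idealMr vN (uN _ am)
                          |apply: shift_idealMl; exact: vN].
Qed.

Fact inv_algc c : inv_pred (algc c).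
Proof. by apply/asboolP=> a _; rewrite algc_central subrr; apply: shift_ideal0. Qed.

(* The subalgebra of all u in A whose class modulo A m_chi is m-invariant. *)
Record inv_alg := InvAlg { inv_val : A; inv_valP : inv_pred inv_val }.
HB.instance Definition _ := [isSub for inv_val].
HB.instance Definition _ := [Choice of inv_alg by <:].
HB.instance Definition _ :=
  GRing.SubChoice_isSubPzRing.Build A inv_pred inv_alg inv_subring.

Definition inv_algc_fun (c : K) : inv_alg := InvAlg (inv_algc c).
Fact inv_algc_is_zmod_morphism : zmod_morphism inv_algc_fun.
Proof. by move=> a b; apply: val_inj; rewrite /= rmorphB. Qed.
Fact inv_algc_is_monoid_morphism : monoid_morphism inv_algc_fun.
Proof. by split=> [|a b]; apply: val_inj; rewrite /= ?rmorph1 ?rmorphM. Qed.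
HB.instance Definition _ :=
  GRing.isZmodMorphism.Build K inv_alg inv_algc_fun inv_algc_is_zmod_morphism.
HB.instance Definition _ :=
  GRing.isMonoidMorphism.Build K inv_alg inv_algc_fun inv_algc_is_monoid_morphism.

Fact inv_algc_central c (x : inv_alg) :
  (inv_algc_fun : {rmorphism K -> inv_alg}) c * x = x * inv_algc_fun c.
Proof. by apply: val_inj; rewrite /= algc_central. Qed.
HB.instance Definition _ := PzRing_isAlgebra.Build K inv_alg inv_algc_central.

Fact inv_ideal0 : shift_ideal (inv_val 0).
Proof. exact: shift_ideal0. Qed.
Fact inv_idealD x y : shift_ideal (inv_val x) -> shift_ideal (inv_val y) ->
  shift_ideal (inv_val (x + y)).
Proof. exact: shift_idealD. Qed.
Fact inv_idealMl a x :
  shift_ideal (inv_val x) -> shift_ideal (inv_val (a * x)).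
Proof. exact: shift_idealMl. Qed.
Fact inv_idealMr a x :
  shift_ideal (inv_val x) -> shift_ideal (inv_val (x * a)).
Proof. by apply: shift_idealMr; apply/asboolP/inv_valP. Qed.

Definition inv_ideal : ideal inv_alg :=
  @Ideal inv_alg (fun x => shift_ideal (inv_val x))
    inv_ideal0 inv_idealD inv_idealMl inv_idealMr.

(* A///_chi m = (A / A m_chi)^m *)
Definition qhr := quot inv_ideal.
HB.instance Definition _ := PzAlgebra.on qhr.

(* The class of u if u is invariant, and 0 otherwise. *)
Definition qhr_class (u : A) : qhr := qproj inv_ideal (insubd 0 u).

End Reduction.

(* ============================== W-algebras ============================== *)

Section WAlgebra.
Variables (K : fieldType) (g : lieAlgType K).

Record grading := Grading {
  piece : int -> {vspace g};
  degrees : seq int;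
  degrees_uniq : uniq degrees;
  piece_degrees : forall d, d \notin degrees -> piece d = 0%VS;
  piece_direct : directv (\sum_(d <- degrees) piece d);
  piece_sum : (\sum_(d <- degrees) piece d)%VS = fullv;
  piece_bracket : forall c d x y,
    x \in piece c -> y \in piece d -> bracket x y \in piece (c + d)
}.

Definition good_grading (G : grading) (e : g) : Prop :=
  [/\ e \in piece G 2,
      forall d x, d <= -1 -> x \in piece G d -> bracket e x = 0 -> x = 0
    & forall d y, -1 <= d -> y \in piece G (d + 2) ->
        exists2 x, x \in piece G d & bracket e x = y].

Definition omega (e x y : g) : K := killing e (bracket x y).

(* l is contained in g_(-1) and equals its own orthogonal there. *)
Definition lagrangian (G : grading) (e : g) (l : {vspace g}) : Prop :=
  forall x, x \in l <->
    x \in piece G (-1) /\ (forall y, y \in l -> omega e x y = 0).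

Definition premet (G : grading) (l : {vspace g}) : {vspace g} :=
  (l + \sum_(d <- degrees G | (d <= -2)%R) piece G d)%VS.

Definition u_qhr (m : {vspace g}) (e : g) : pzAlgType K :=
  qhr m (@uea_in K g) (killing e).

Definition W_algebra (G : grading) (l : {vspace g}) (e : g) : pzAlgType K :=
  u_qhr (premet G l) e.

End WAlgebra.

(* ================================= sl_n ================================= *)

Section SpecialLinear.
Variables (K : fieldType) (n : nat).

Definition sl_space : {vspace 'M[K]_n} :=
  lker (linfun (mxtrace : 'M[K]_n -> K^o)).

Definition sl := subvs_of sl_space.
HB.instance Definition _ := Vector.on sl.

Lemma mem_sl_space (A : 'M[K]_n) : (A \in sl_space) = (\tr A == 0).
Proof. by rewrite memv_ker lfunE. Qed.

Fact sl_bracket_subproof (x y : sl) :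
  vsval x *m vsval y - vsval y *m vsval x \in sl_space.
Proof. by rewrite mem_sl_space linearB /= mxtrace_mulC subrr. Qed.

Definition sl_bracket (x y : sl) : sl := Subvs (sl_bracket_subproof x y).

Fact sl_bracketPl y : linear (sl_bracket^~ y).
Proof.
move=> c x x'; have E (u v : sl) : vsval (c *: u + v) = c *: vsval u + vsval v.
  exact: linearP.
apply: val_inj; transitivity (c *: vsval (sl_bracket x y)
  + vsval (sl_bracket x' y)); last by rewrite -E.
rewrite -[LHS]/(vsval (c *: x + x') *m vsval y
  - vsval y *m vsval (c *: x + x')) E mulmxDl mulmxDr -scalemxAl -scalemxAr.
by rewrite opprD addrACA -scalerBr.
Qed.
Fact sl_bracketPr x : linear (sl_bracket x).
Proof.
move=> c y y'; have E (u v : sl) : vsval (c *: u + v) = c *: vsval u + vsval v.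
  exact: linearP.
apply: val_inj; transitivity (c *: vsval (sl_bracket x y)
  + vsval (sl_bracket x y')); last by rewrite -E.
rewrite -[LHS]/(vsval x *m vsval (c *: y + y')
  - vsval (c *: y + y') *m vsval x) E mulmxDl mulmxDr -scalemxAl -scalemxAr.
by rewrite opprD addrACA -scalerBr.
Qed.
Fact sl_bracketxx x : sl_bracket x x = 0.
Proof. by apply: val_inj; rewrite /= subrr. Qed.
Fact sl_jacobi x y z :
  sl_bracket x (sl_bracket y z) + sl_bracket y (sl_bracket z x)
    + sl_bracket z (sl_bracket x y) = 0.
Proof.
apply: val_inj => /=; move: (vsval x) (vsval y) (vsval z) => {x y z} x y z.
rewrite !mulmxBl !mulmxBr !mulmxA.
move: (x *m y *m z) (x *m z *m y) (y *m z *m x) (y *m x *m z)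
      (z *m x *m y) (z *m y *m x) => a b c d e h.
by apply/matrixP=> i j; rewrite !mxE; ring.
Qed.

HB.instance Definition _ := Vector_isLie.Build K sl
  sl_bracketPl sl_bracketPr sl_bracketxx sl_jacobi.

(* The sum of the matrix units E_(k,l) with P k l. The projection onto sl_n
   does nothing if P is irreflexive, which holds in all uses below provided
   that i <> j there. *)
Definition sl_units (P : rel 'I_n) : sl :=
  vsproj sl_space (\sum_(k < n) \sum_(l < n | P k l) delta_mx k l).

Lemma val_sl_units (P : rel 'I_n) : irreflexive P ->
  vsval (sl_units P) = \sum_(k < n) \sum_(l < n | P k l) delta_mx k l.
Proof.
move=> irrP; apply: vsprojK; rewrite mem_sl_space raddf_sum big1 // => k _.
rewrite raddf_sum big1 //= => l Pkl; apply: big1 => s _.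
rewrite mxE; case: eqVneq => // sk; case: eqVneq => // sl.
by move: Pkl; rewrite -sk -sl irrP.
Qed.

End SpecialLinear.

(* =============================== Pyramids =============================== *)

Section Pyramid.
Variables (K : fieldType) (n : nat) (mu : seq nat).

(* The boxes (row, column) of the right-aligned pyramid of shape mu, in the
   order of their labels. Rows are numbered from 1 starting at the bottom, and
   columns from 0 starting at the left. *)
Definition boxes : seq (nat * nat) :=
  let w := head 0%N mu in
  [seq (r, c) | c <- iota 0 w,
                r <- [seq r <- iota 1 (size mu) | (w - nth 0 mu r.-1 <= c)%N]].

Definition row_of (k : 'I_n) : nat := (nth (0, 0)%N boxes k).1.

Definition col_of (k : 'I_n) : int := ((nth (0, 0)%N boxes k).2 * 2)%N.

Definition arrow (k l : 'I_n) : bool :=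
  (row_of k == row_of l) && (col_of l == col_of k + 2).

Definition pyr_e1 : sl K n := sl_units K arrow.

Definition pyr_deg (k l : 'I_n) : int := col_of l - col_of k.

Definition pyr_degrees : seq int :=
  undup [seq pyr_deg p.1 p.2 | p : 'I_n * 'I_n].

Definition units_of_deg (d : int) : seq 'M[K]_n :=
  [seq delta_mx p.1 p.2 | p <- enum {: 'I_n * 'I_n} & pyr_deg p.1 p.2 == d].

(* The traceless matrices in the span of the E_(k,l) of degree d. *)
Definition pyr_piece (d : int) : {vspace sl K n} :=
  (linfun vsval @^-1: span (units_of_deg d))%VS.

Definition pyr_m1 : {vspace sl K n} :=
  (\sum_(d <- pyr_degrees | (d <= -2)%R) pyr_piece d)%VS.

Section Cover.
Variables i j : nat.

Definition pyr_e2 : sl K n :=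
  pyr_e1 + sl_units K (fun k l =>
    [&& row_of k == i, row_of l == j & col_of k == col_of l]).

Definition pyr_E (m : nat) : sl K n := sl_units K (fun l k =>
  [&& i <= row_of k, row_of k < row_of l, row_of l <= j,
      row_of l - row_of k == m & col_of k == col_of l]%N).

Definition pyr_k : {vspace sl K n} :=
  span [seq pyr_E m | m <- iota 1 (j - i)].

Definition pyr_m2 : {vspace sl K n} := (pyr_m1 + pyr_k)%VS.

(* U(g,e_1) = U(g)///_chi_1 m_1 *)
Definition U_e1 : pzAlgType K := u_qhr pyr_m1 pyr_e1.

Definition class_e1 : uea (sl K n) -> U_e1 :=
  @qhr_class K _ _ pyr_m1 (@uea_in K (sl K n)) (killing pyr_e1).

(* The comoment map k -> U(g,e_1). The elements of k are invariant: k commutes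
   with e_1 and normalises m_1. *)
Definition comoment (y : sl K n) : U_e1 := class_e1 (uea_in y).

Definition kappa : sl K n -> K := killing pyr_e2.

(* U(g,e_1)///_kappa k *)
Definition U_e1_k : pzAlgType K := qhr pyr_k comoment kappa.

Definition class_e1_k : U_e1 -> U_e1_k := @qhr_class K _ _ pyr_k comoment kappa.

(* U(g)///_chi_2 m_2 *)
Definition U_m2 : pzAlgType K := u_qhr pyr_m2 pyr_e2.

Definition class_m2 : uea (sl K n) -> U_m2 :=
  @qhr_class K _ _ pyr_m2 (@uea_in K (sl K n)) (killing pyr_e2).

(* phi is induced by the identity on representatives: a representative u of
   an element of U(g,e_1)///_kappa k also represents an element of
   U(g)///_chi_2 m_2, and phi maps the former to the latter. *)
Definition induced_by_id (phi : U_e1_k -> U_m2) : Prop :=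
  forall u : uea (sl K n),
    invariant pyr_m1 (@uea_in K _) (killing pyr_e1) u ->
    invariant pyr_k comoment kappa (class_e1 u) ->
    invariant pyr_m2 (@uea_in K _) (killing pyr_e2) u /\
      phi (class_e1_k (class_e1 u)) = class_m2 u.

End Cover.
End Pyramid.

(* Main.v *)
From HB Require Import structures.
From mathcomp Require Import all_boot all_order all_algebra.
From mathcomp Require Import boolp reals complex finmap.
From mathcomp Require Import monalg ring zify.
Require Import Defs.

(** Why the theorem holds.  Write s(a) = a - chi(a), and let I_1 and I_2 be the
    left ideals of U(g) generated by the s(a) with a in m_1, resp. m_2.  A class
    modulo I is invariant iff its representatives u satisfy s(a) u in I for all
    a in m (invariantP).  Here k is the line spanned by the matrix unit
    f = E_(n,n-1), the algebra m_2 consists of the strictly lower triangular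
    matrices, e_2 is the regular Jordan block, and I_2 = I_1 + U s(f).

    Reduction by stages.  The identity on representatives induces an isomorphism
    as soon as (1) every m_1-invariant element of I_2 is v s(f) modulo I_1 with
    v again m_1-invariant, and (2) every m_2-invariant class modulo I_2 has an
    m_1-invariant representative modulo I_1 (reduction_by_stages).  Both say that
    m_1-invariants lift along a surjection of left U(g)-modules, U/I_1 -> U/J: in
    (2) J is I_2, and in (1) J is the kernel of right multiplication by s(f) into
    U/I_1.  Such lifts exist (invariant_lift) because m_1 has slices: order its
    matrix units E_(k,c) by columns; on the vectors killed by the earlier ones,
    s = s(E_(k,c)) acts locally nilpotently, and left multiplication by
    b = E_(c+1,k) satisfies [s, b] = - (2n + eps s) with eps = 0 or 1, since
    chi(E_(c+1,c)) = 2n.  As for d/dx and x, this makes s surjective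
    (slice_surjective), so that a lift can be corrected one unit at a time.

    Comparison with the W-algebra.  The principal grading, deg E_(k,l) = 2(l - k),
    is even and good for e_2 (regular_good_grading), and its Premet subalgebra is
    m_2.  Any other good grading is conjugate to it by an element fixing e_2.  Its
    degree derivation is inner, say ad h, because the Killing form
    2n tr(xy) is nondegenerate (sl_derivation_inner).  If h_0 is the diagonal
    element defining the principal grading, h - h_0 commutes with the Jordan block
    e_2, so it is an upper triangular Toeplitz matrix with zero diagonal.  A row
    eigenvector w of h for the top eigenvalue n - 1 has nonzero first entry, and
    the matrix P with rows w, w e_2, w e_2^2, ... commutes with e_2 and conjugates
    h to h_0 (neutral_conjugate).  Conjugation by P preserves the character, sends
    the Premet subalgebra to m_2, and therefore induces an isomorphism of the
    reductions (u_qhr_isomorphic). *)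

Set Implicit Arguments.
Unset Strict Implicit.
Unset Printing Implicit Defensive.

Import Order.TTheory GRing.Theory Num.Theory.
Local Open Scope ring_scope.

(** * The universal enveloping algebra *)

Section Uea.
Variables (K : fieldType) (g : lieAlgType K).
Implicit Types (x y : g) (u v : uea g).

Lemma gen_ideal_gen (A : pzRingType) (S : A -> Prop) (a : A) : S a -> gen_ideal S a.
Proof. by move=> Sx J; apply. Qed.

Lemma uea_inD x y : uea_in (x + y) = uea_in x + uea_in y.
Proof.
rewrite /uea_in -rmorphD; apply/qprojP/gen_ideal_gen; exact: UeaAdd.
Qed.

Lemma uea_inZ c x : uea_in (c *: x) = algc c * uea_in x.
Proof.
rewrite [RHS](_ : _ = qproj (gen_ideal (@uea_rel K g)) (algc c * free_gen K x)).
  by apply/qprojP/gen_ideal_gen; exact: UeaScale.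
by rewrite rmorphM.
Qed.

Lemma uea_in_bracket x y :
  uea_in (bracket x y) = uea_in x * uea_in y - uea_in y * uea_in x.
Proof.
rewrite /uea_in -!rmorphM -rmorphB; apply/esym/qprojP/gen_ideal_gen.
exact: UeaBracket.
Qed.

Lemma uea_in0 : uea_in (0 : g) = 0.
Proof. by rewrite -(scale0r 0) uea_inZ rmorph0 mul0r. Qed.

Lemma uea_inN x : uea_in (- x) = - uea_in x.
Proof. by rewrite -scaleN1r uea_inZ rmorphN rmorph1 mulN1r. Qed.

Lemma rmorph_mulCA (A B : pzRingType) (q : {rmorphism A -> B}) (a b c : A) :
  q a * q b = q b * q a -> q (a * (b * c)) = q b * q (a * c).
Proof. by move=> E; rewrite !rmorphM !mulrA E. Qed.

(** U(g) is generated as an algebra by g, because the free algebra is spanned by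
    words in the elements of g. *)
Lemma uea_inP (P : uea g -> Prop) :
  (forall c, P (algc c)) -> (forall u v, P u -> P v -> P (u + v)) ->
  (forall x u, P u -> P (uea_in x * u)) -> forall u, P u.
Proof.
move=> Pc PD PM.
pose q : {rmorphism free_alg K g -> uea g} := qproj (gen_ideal (@uea_rel K g)).
have qM : forall a b : free_alg K g, q (a * b) = q a * q b := rmorphM q.
have qD : forall a b : free_alg K g, q (a + b) = q a + q b := rmorphD q.
pose mon s : free_alg K g := << 1 *g FMonom s >>.
have Pmon s c : P (q (malgC c * mon s)).
  elim: s => [|x s IHs].
    have -> : mon [::] = 1 by rewrite /mon -[FMonom _]fmoneE.
    by rewrite mulr1; apply: Pc.
  have -> : mon (x :: s) = free_gen K x * mon s.
    rewrite /mon /free_gen malgM_def fgmulUU mul1r; congr (<< 1 *g _ >>).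
    by rewrite [RHS]fmmulE fmuE.
  rewrite (rmorph_mulCA (q := q) (b := free_gen K x)); last first.
    exact: (algc_central c (q (free_gen K x))).
  exact/PM.
apply: quot_ind => z; rewrite -[qproj _ _]/(q z).
have -> : z = \sum_(k <- msupp z) malgC z@_k * mon (fmonom_val k) :> free_alg K g.
  rewrite {1}(monalgE z); apply: eq_bigr => -[s] _.
  by rewrite mul_malgC; apply/malgP => k; rewrite mcoeffZ !mcoeffU mulr_natr.
elim: (enum_fset _) => [|k r IHr].
  by rewrite big_nil; have := Pc 0; rewrite rmorph0 (rmorph0 q).
by rewrite big_cons qD; apply: PD.
Qed.

End Uea.

Section UeaMap.
Variables (K : fieldType) (g : lieAlgType K) (sigma : g -> g).

Let hmon (m : {fmonom g}) : free_alg K g := << 1 *g FMonom (map sigma m) >>.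

Fact hmon_mmorphism : mmorphism hmon.
Proof.
split=> [m1 m2|]; rewrite /hmon.
  rewrite malgM_def fgmulUU mul1r; congr (<< 1 *g _ >>).
  by rewrite fmM map_cat [RHS]fmmulE.
by rewrite fm1 /= -[FMonom _]fmoneE.
Qed.
HB.instance Definition _ := isMultiplicative.Build _ _ hmon hmon_mmorphism.

Let fmap : free_alg K g -> free_alg K g := mmap (@malgC {fmonom g} K) hmon.

Fact fmap_zmod : zmod_morphism fmap.
Proof. exact: mmap_is_additive. Qed.
Fact fmap_mon : monoid_morphism fmap.
Proof.
have H : multiplicative fmap.
  by apply: commr_mmap_is_multiplicative => z m m'; apply: free_algc_central.
by split; [exact: H.2|exact: H.1].
Qed.
HB.instance Definition _ := GRing.isZmodMorphism.Build _ _ fmap fmap_zmod.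
HB.instance Definition _ := GRing.isMonoidMorphism.Build _ _ fmap fmap_mon.

Lemma fmap_gen x : fmap (free_gen K x) = free_gen K (sigma x).
Proof. by rewrite /fmap mmapU mul1r /hmon fmU /free_gen fmuE. Qed.

Lemma fmap_algc c : fmap (algc c) = algc c.
Proof. exact: mmapC. Qed.

Hypothesis sigma_lin : linear sigma.
Hypothesis sigma_bracket : forall x y, sigma (bracket x y) = bracket (sigma x) (sigma y).

Let J := gen_ideal (@uea_rel K g).

(** The substitution x |-> sigma x in words carries each defining relation to a
    defining relation exactly because sigma is a morphism of Lie algebras. *)
Lemma fmap_ideal z : J z -> J (fmap z).
Proof.
pose P := fun z => J (fmap z).
have P0 : P 0 by rewrite /P rmorph0; apply: ideal0.
have PD x y : P x -> P y -> P (x + y).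
  by rewrite /P rmorphD; apply: idealD.
have Pl a x : P x -> P (a * x) by rewrite /P rmorphM; apply: idealMl.
have Pr a x : P x -> P (x * a) by rewrite /P rmorphM; apply: idealMr.
have fB : {morph fmap : a b / a - b} := rmorphB _.
have fD : {morph fmap : a b / a + b} := rmorphD _.
have fM : {morph fmap : a b / a * b} := rmorphM _.
move=> /(_ (Ideal P0 PD Pl Pr)); apply => s [x y|c x|x y] /=; rewrite /P.
- have E : sigma (x + y) = sigma x + sigma y.
    by have := sigma_lin 1 x y; rewrite !scale1r.
  rewrite fB fD !fmap_gen E.
  by apply/gen_ideal_gen/UeaAdd.
- have E : sigma (c *: x) = c *: sigma x.
    have s0 : sigma 0 = 0.
      have := sigma_lin 1 0 0; rewrite !scale1r addr0 => /eqP.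
      by rewrite -subr_eq0 opprD addrA subrr sub0r oppr_eq0 => /eqP.
    by have := sigma_lin c x 0; rewrite !addr0 s0 addr0.
  rewrite fB fM !fmap_gen fmap_algc E.
  by apply/gen_ideal_gen/UeaScale.
rewrite !fB !fM !fmap_gen sigma_bracket.
by apply/gen_ideal_gen/UeaBracket.
Qed.

(** The functoriality of U(g) in g, for endomorphisms. *)
Lemma uea_map_exists : exists F : {rmorphism uea g -> uea g},
  (forall c, F (algc c) = algc c) /\ (forall x, F (uea_in x) = uea_in (sigma x)).
Proof.
pose F (u : uea g) : uea g := qproj J (fmap (repr u)).
have FE z : F (qproj J z) = qproj J (fmap z).
  by apply/qprojP; rewrite -rmorphB; apply/fmap_ideal/repr_qproj.
have Fz : zmod_morphism F.
  by do 2!elim/quot_ind=> ?; rewrite -rmorphB !FE !rmorphB.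
have Fm : monoid_morphism F.
  split; first by rewrite -(rmorph1 (qproj J)) FE !rmorph1.
  by do 2!elim/quot_ind=> ?; rewrite -rmorphM !FE !rmorphM.
pose F1 := GRing.isZmodMorphism.Build _ _ F Fz.
pose F2 := GRing.isMonoidMorphism.Build _ _ F Fm.
pose FF : {rmorphism uea g -> uea g} := HB.pack F F1 F2.
exists FF; split => [c|x]; rewrite /= FE.
  by rewrite fmap_algc.
by rewrite fmap_gen.
Qed.

End UeaMap.

(** * Lifting invariants by slices *)

Record left_ideal (A : pzRingType) (I : A -> Prop) : Prop := LeftIdeal {
  left_ideal0 : I 0;
  left_idealD : forall x y, I x -> I y -> I (x + y);
  left_idealM : forall a x, I x -> I (a * x)
}.

Section LeftIdeal.
Variables (A : pzRingType) (I : A -> Prop).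
Hypothesis Il : left_ideal I.

Lemma left_idealN x : I x -> I (- x).
Proof. by move=> Ix; rewrite -mulN1r; apply: (left_idealM Il). Qed.

Lemma left_idealB x y : I x -> I y -> I (x - y).
Proof. by move=> Ix Iy; apply: (left_idealD Il) => //; apply: left_idealN. Qed.

Lemma left_idealMn x n : I x -> I (x *+ n).
Proof. by move=> Ix; rewrite -mulr_natl; apply: (left_idealM Il). Qed.

Definition commutator (s x : A) := s * x - x * s.

Lemma commutatorE s x : s * x = x * s + commutator s x.
Proof. by rewrite /commutator addrC subrK. Qed.

(** If ad s kills x in j steps, then multiplying by x costs at most j further
    powers of s: in s x t = x (s t) + [s, x] t the first term needs one power of s
    less on t, and the second one commutator less.  This propagates local
    nilpotency of s on A/I from generators to products. *)
Lemma ad_nilpotent_mul s j N x t :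
  iter j (commutator s) x = 0 -> I (s ^+ N * t) -> I (s ^+ (N + j) * (x * t)).
Proof.
have [n] := ubnP (j + N); elim: n => // n IHn in j N x t *.
case: j => [|j] leN; first by move=> /= -> _; rewrite mul0r mulr0; exact: (left_ideal0 Il).
case: N leN => [|N] leN adx.
  by rewrite expr0 mul1r => It; do 2!apply: (left_idealM Il).
move=> INt; rewrite addSn exprSr -mulrA [s * _]mulrA (commutatorE s x).
rewrite mulrDl mulrDr; apply: (left_idealD Il).
  rewrite -mulrA; apply: IHn => //; first by lia.
  by rewrite mulrA -exprSr.
rewrite -addSnnS; apply: IHn; [by lia| |by []].
by move: adx; rewrite iterSr.
Qed.

End LeftIdeal.

(** P/I plays the role of a module on which s is locally nilpotent and b is a
    slice for s: [s, b] = - (kappa + eps s) with kappa invertible.  Elements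
    of P/I are handled through their representatives in A. *)
Section Slice.
Variables (K : numFieldType) (A : pzAlgType K) (I P : A -> Prop).
Hypothesis Il : left_ideal I.
Hypotheses (PD : forall x y, P x -> P y -> P (x + y))
  (Pc : forall c x, P x -> P (algc c * x)).
Variables (s b : A) (kappa eps : K).
Hypotheses (Ps : forall x, P x -> P (s * x)) (Pb : forall x, P x -> P (b * x)).
Hypothesis kappa0 : kappa != 0.
Hypothesis slice : forall x, P x ->
  I ((commutator s b + algc kappa + algc eps * s) * x).

Lemma P_exp n x : P x -> P (s ^+ n * x).
Proof. by elim: n => [|n IHn] Px; rewrite ?mul1r // exprS -mulrA; apply/Ps/IHn. Qed.

(** The analogue of [d^n, x] = n d^(n-1). *)
Lemma slice_exp n x : P x ->
  I (s ^+ n.+1 * (b * x) - b * (s ^+ n.+1 * x)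
     + (algc kappa * (s ^+ n * x) + algc eps * (s ^+ n.+1 * x)) *+ n.+1).
Proof.
move=> Px; elim: n => [|n IHn].
  have := slice Px; rewrite /commutator !mulrDl !mulNr expr0 expr1 mul1r mulr1n.
  by rewrite -!mulrA addrA.
have := left_idealM Il s IHn; move/(left_idealD Il (slice (P_exp n.+1 Px))).
congr I; rewrite (exprS s n.+1) (mulrS _ n.+1).
rewrite mulrDr mulrBr mulrnAr mulrDr (mulrA s (algc kappa)) (mulrA s (algc eps)).
rewrite -!algc_central -!mulrA !mulrDl ?mulNr -!mulrA.
rewrite (mulrA s (s ^+ n) x) -exprS.
set X := s * (b * _); set Z := algc kappa * _.
set W := algc eps * _; set V := s * (_ * (b * x)); set Q := (_ *+ n.+1).
rewrite !addrA; congr (_ + Q); rewrite -!addrA addrC !addrA subrK addrC.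
by rewrite !addrA.
Qed.

(** Integration by parts: if s^(n+1) x = 0, the element y = s b x + (n+1) kappa x
    is killed by s^n, so y = s w' by induction, and x is a multiple of
    s (w' - b x). *)
Lemma slice_surjective n x : P x -> I (s ^+ n * x) ->
  exists2 w, P w & I (s * w - x).
Proof.
elim: n x => [|n IHn] x Px.
  rewrite mul1r => Ix; exists (algc 0 * x); first exact: Pc.
  by rewrite rmorph0 mul0r mulr0 sub0r; apply: left_idealN.
move=> Isx; pose c := kappa *+ n.+1.
have c0 : c != 0 by rewrite mulrn_eq0.
pose y := s * (b * x) + algc c * x.
have Py : P y by apply: PD; [exact/Ps/Pb|exact: Pc].
have Isy : I (s ^+ n * y).
  have -> : s ^+ n * y = (s ^+ n.+1 * (b * x) - b * (s ^+ n.+1 * x)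
     + (algc kappa * (s ^+ n * x) + algc eps * (s ^+ n.+1 * x)) *+ n.+1)
     + (b * (s ^+ n.+1 * x) - (algc eps * (s ^+ n.+1 * x)) *+ n.+1).
    rewrite mulrDr mulrA -exprSr (mulrA _ (algc c)) -algc_central -mulrA.
    rewrite rmorphMn /= mulrnAl mulrnDl; set X := _ * (b * x).
    set Y := b * _; set Q := (algc kappa * _) *+ _; set W := _ *+ _.
    by rewrite addrA addrAC (addrA (X - Y)) addrK addrAC subrK.
  apply: (left_idealD Il); first exact: slice_exp.
  apply: (left_idealB Il); first exact: (left_idealM Il).
  exact/(left_idealMn Il)/(left_idealM Il).
have [w' Pw' Iw'] := IHn y Py Isy.
exists (algc c^-1 * (w' - b * x)).
  apply/Pc/PD => //; rewrite -mulN1r -(rmorph1 (@algc K A)) -rmorphN.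
  exact/Pc/Pb.
have -> : s * (algc c^-1 * (w' - b * x)) - x = algc c^-1 * (s * w' - y).
  rewrite mulrA -algc_central -mulrA mulrBr opprD addrA [RHS]mulrDr.
  congr (_ + _); rewrite mulrN mulrA -rmorphM mulVf // rmorph1 mul1r //.
exact: left_idealM.
Qed.

End Slice.

Section SliceChain.
Variables (K : numFieldType) (A : pzAlgType K).
Variables (a : nat -> A) (act : pred nat) (M : nat).

(** The left ideal generated by the active a k with k < N; membership is phrased
    through all left ideals D so that it transports along z |-> z x. *)
Definition comb_below N (z : A) : Prop := forall D : A -> Prop, left_ideal D ->
  (forall k, (k < N)%N -> act k -> D (a k)) -> D z.

Hypothesis comm_below : forall N k, (N < M)%N -> act N -> (k < N)%N -> act k ->
  comb_below N (commutator (a k) (a N)).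
Hypothesis slices : forall N, (N < M)%N -> act N -> exists b kappa eps,
  [/\ kappa != 0,
      forall k, (k < N)%N -> act k -> comb_below N (commutator (a k) b)
    & comb_below N (commutator (a N) b + algc kappa + algc eps * a N)].

Variables I J : A -> Prop.
Hypotheses (Il : left_ideal I) (Jl : left_ideal J).
Hypothesis Inil : forall k, (k < M)%N -> act k -> forall x, exists n, I (a k ^+ n * x).

Let below N x := forall k, (k < N)%N -> act k -> I (a k * x).

Lemma comb_belowP N z x : comb_below N z -> below N x -> I (z * x).
Proof.
move=> zN xN; apply: (zN (fun z => I (z * x))) => //; split=> [|u v|c u].
- by rewrite mul0r; apply: left_ideal0.
- by rewrite mulrDl; apply: left_idealD.
- by rewrite -mulrA; apply: left_idealM.
Qed.

Lemma below_stable N u x : (forall k, (k < N)%N -> act k ->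
  comb_below N (commutator (a k) u)) -> below N x -> below N (u * x).
Proof.
move=> uN xN k kN ak; rewrite mulrA (commutatorE (a k) u) mulrDl.
apply: (left_idealD Il); last exact: comb_belowP (uN k kN ak) xN.
by rewrite -mulrA; apply/(left_idealM Il)/xN.
Qed.

(** For J containing I: exactness of the functor of invariants along A/I -> A/J.  If v lifts u and is
    killed modulo I by all a k with k < N, the defect x = a N * v lies in J and
    is still killed by them; since a N is surjective on such elements of J/I,
    x = a N * w, and v - w is killed by a N as well. *)
Lemma invariant_lift u : (forall k, (k < M)%N -> act k -> J (a k * u)) ->
  exists2 v, J (u - v) & forall k, (k < M)%N -> act k -> I (a k * v).
Proof.
move=> uJ.
suff: forall N, (N <= M)%N -> exists2 v, J (u - v) & below N v by apply.
elim=> [|N IHN] NM; first by exists u => //; rewrite subrr; apply: left_ideal0.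
have [v Juv vN] := IHN (ltnW NM).
have [aN|aN] := boolP (act N); last first.
  exists v => // k; rewrite ltnS leq_eqVlt => /orP[/eqP->|]; last exact: vN.
  by rewrite (negbTE aN).
have [b [kappa [eps [kappa0 bN slice]]]] := slices NM aN.
pose P x := J x /\ below N x.
have PD x y : P x -> P y -> P (x + y).
  move=> [Jx xN] [Jy yN]; split=> [|k kN ak]; first exact: left_idealD.
  by rewrite mulrDr; apply: (left_idealD Il); [exact: xN|exact: yN].
have PM c x : (forall k, (k < N)%N -> act k -> comb_below N (commutator (a k) c)) ->
    P x -> P (c * x).
  by move=> cN [Jx xN]; split; [exact: left_idealM|exact: below_stable].
have Ps x : P x -> P (a N * x) by apply: PM => k kN; apply: comm_below.
have Pc c x : P x -> P (algc c * x).
  apply: PM => k _ _ D Dl _; rewrite /commutator algc_central subrr.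
  exact: left_ideal0.
have Px : P (a N * v).
  split; last by apply: below_stable => // k kN; apply: comm_below.
  rewrite -[v](subKr u) mulrBr; apply: (left_idealB Jl); first exact: uJ.
  exact: left_idealM.
have [n In] := Inil NM aN (a N * v).
have Pb x : P x -> P (b * x) by apply: PM.
have Sl x : P x -> I ((commutator (a N) b + algc kappa + algc eps * a N) * x).
  by move=> [_ xN]; apply: comb_belowP slice xN.
have [w [Jw wN] Iw] := slice_surjective Il PD Pc Ps Pb kappa0 Sl Px In.
exists (v - w); first by rewrite opprB addrCA addrC; apply: left_idealD.
move=> k; rewrite ltnS leq_eqVlt => /orP[/eqP-> _|kN ak].
  by rewrite mulrBr -opprB; apply: left_idealN.
by rewrite mulrBr; apply: (left_idealB Il); [exact: vN|exact: wN].
Qed.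
End SliceChain.

(** * Isomorphisms and quantum Hamiltonian reductions *)

Section AlgIso.
Variables (K : comNzRingType) (A B : pzAlgType K) (R : A -> B -> Prop).
Hypotheses (Rtot : forall a, exists b, R a b) (Rsurj : forall b, exists a, R a b).
Hypotheses (R0l : forall b, R 0 b -> b = 0) (R0r : forall a, R a 0 -> a = 0).
Hypotheses
  (RB : forall a b a' b', R a b -> R a' b' -> R (a - a') (b - b'))
  (RM : forall a b a' b', R a b -> R a' b' -> R (a * a') (b * b'))
  (Rc : forall c, R (algc c) (algc c)).

(** Isomorphisms of reductions are described on representatives, hence by a
    relation between classes; this turns such a relation into a morphism. *)
Lemma alg_iso_of_rel :
  exists f : {rmorphism A -> B}, alg_iso f /\ forall a b, R a b -> f a = b.
Proof.
pose f a := projT1 (cid (Rtot a)).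
have Rf a : R a (f a) by rewrite /f; case: cid.
have fE a b : R a b -> f a = b.
  move=> Rab; apply/eqP; rewrite -subr_eq0; apply/eqP/R0l.
  by rewrite -(subrr a); apply: RB.
have fz : zmod_morphism f by move=> a b; apply/fE/RB.
have fm : monoid_morphism f.
  split=> [|a b]; last exact/fE/RM.
  by apply: fE; rewrite -(rmorph1 algc) -[X in R _ X](rmorph1 algc).
pose F1 := GRing.isZmodMorphism.Build _ _ f fz.
pose F2 := GRing.isMonoidMorphism.Build _ _ f fm.
pose F : {rmorphism A -> B} := HB.pack f F1 F2.
exists F; split=> //; split=> [c|]; first exact: fE.
have ex b : exists a, f a == b.
  by have [a Rab] := Rsurj b; exists a; apply/eqP/fE.
pose h b := xchoose (ex b).
have hK : cancel h F by move=> b; apply/eqP/(xchooseP (ex b)).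
have Finj : injective F.
  move=> a a' Eaa'; apply/eqP; rewrite -subr_eq0; apply/eqP/R0r.
  have := RB (Rf a) (Rf a'); rewrite [f a](_ : _ = f a') ?subrr //.
by exists h => // a; apply: Finj; rewrite hK.
Qed.
End AlgIso.

Section AlgIsomorphic.
Variable K : comNzRingType.
Implicit Types A B C : pzAlgType K.

Lemma alg_isomorphic_sym A B : alg_isomorphic A B -> alg_isomorphic B A.
Proof.
move=> [f [fc fbij]].
have [|||||||F [Fiso _]] := @alg_iso_of_rel K B A (fun b a => f a = b).
- by move=> b; have [h _ fh] := fbij; exists (h b).
- by move=> a; exists (f a).
- by move=> a fa0; apply: (bij_inj fbij); rewrite fa0 rmorph0.
- by move=> b <-; rewrite rmorph0.
- by move=> b a b' a' <- <-; rewrite rmorphB.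
- by move=> b a b' a' <- <-; rewrite rmorphM.
- exact: fc.
by exists F.
Qed.

Lemma alg_isomorphic_trans A B C :
  alg_isomorphic A B -> alg_isomorphic B C -> alg_isomorphic A C.
Proof.
move=> [f [fc fbij]] [h [hc hbij]]; exists (h \o f : {rmorphism A -> C}).
by split=> [c|]; [rewrite /= fc hc|apply: bij_comp].
Qed.
End AlgIsomorphic.

Section ReductionTheory.
Variables (K : fieldType) (V : vectType K) (A : pzAlgType K).
Variables (m : {vspace V}) (f : V -> A) (chi : V -> K).

Local Notation I := (shift_ideal m f chi).
Local Notation s := (shift f chi).
Local Notation cl := (@qhr_class K V A m f chi).
Local Notation inv := (invariant m f chi).

Lemma shift_ideal_left : left_ideal I.
Proof.
split; [exact: shift_ideal0|exact: shift_idealD|exact: shift_idealMl].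
Qed.

Lemma shift_ideal_gen y : y \in m -> I (s y).
Proof. by move=> ym; exists [:: (1, y)]; rewrite /= ym big_seq1 mul1r. Qed.

Lemma shift_ideal_min (D : A -> Prop) x : left_ideal D ->
  (forall y, y \in m -> D (s y)) -> I x -> D x.
Proof.
move=> Dl Ds [r [rm ->]]; rewrite big_seq; apply: (big_ind D) => [||p pr].
- exact: left_ideal0.
- exact: left_idealD.
exact/(left_idealM Dl)/Ds/(allP rm).
Qed.

(** [a, u] and s(a) u differ by u s(a), which lies in the left ideal. *)
Lemma invariantP u : inv u <-> forall a, a \in m -> I (s a * u).
Proof.
have E a : f a * u - u * f a = s a * u - u * s a.
  by rewrite /shift mulrBl mulrBr algc_central opprB addrA subrK.
split=> H a am; have := H a am; rewrite E.
  move/(shift_idealD (shift_idealMl u (shift_ideal_gen am))).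
  by rewrite addrC subrK.
move=> /shift_idealD; apply; apply: shift_idealN.
exact/shift_idealMl/shift_ideal_gen.
Qed.

Lemma inv_val_class u : inv u -> inv_val (insubd (0 : inv_alg m f chi) u) = u.
Proof. by move=> iu; apply: insubdK; apply/asboolP. Qed.

Lemma invariantB u v : inv u -> inv v -> inv (u - v).
Proof.
move=> /asboolP iu /asboolP iv; apply/asboolP.
by have [_ /(_ u v iu iv)] := inv_subring m f chi.
Qed.

Lemma invariantM u v : inv u -> inv v -> inv (u * v).
Proof.
move=> /asboolP iu /asboolP iv; apply/asboolP.
by have [_ _ /(_ u v iu iv)] := inv_subring m f chi.
Qed.

Lemma invariant_algc c : inv (algc c).
Proof. exact/asboolP/inv_algc. Qed.

Lemma invariant_ideal u : I u -> inv u.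
Proof. by move=> Iu; apply/invariantP => a _; apply: shift_idealMl. Qed.

Lemma qhr_classP u v : inv u -> inv v -> (cl u = cl v <-> I (u - v)).
Proof.
by move=> iu iv; rewrite qprojP /inv_ideal /= !inv_val_class.
Qed.

Lemma qhr_classB u v : inv u -> inv v -> cl (u - v) = cl u - cl v.
Proof.
move=> iu iv; rewrite /qhr_class -rmorphB; congr (qproj _ _); apply: val_inj.
by rewrite /= !inv_val_class //; apply: invariantB.
Qed.

Lemma qhr_classM u v : inv u -> inv v -> cl (u * v) = cl u * cl v.
Proof.
move=> iu iv; rewrite /qhr_class -rmorphM; congr (qproj _ _); apply: val_inj.
by rewrite /= !inv_val_class //; apply: invariantM.
Qed.

Lemma qhr_class_algc c : cl (algc c) = algc c.
Proof.
congr (qproj _ _); apply: val_inj.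
by rewrite /= inv_val_class //; apply: invariant_algc.
Qed.

Lemma qhr_class_eq0 u : inv u -> (cl u = 0 <-> I u).
Proof.
move=> iu; have := qhr_classP iu (invariant_algc 0).
by rewrite qhr_class_algc !rmorph0 subr0.
Qed.

Lemma qhr_class_surj q : exists2 u, inv u & q = cl u.
Proof.
elim/quot_ind: q => x; exists (inv_val x); first exact/asboolP/inv_valP.
by congr (qproj _ _); apply: val_inj; rewrite /= inv_val_class //; apply/asboolP/inv_valP.
Qed.

End ReductionTheory.

(** * Reduction by stages *)

Section Stages.
Variables (K : fieldType) (V : vectType K) (A : pzAlgType K).
Variables (m1 : {vspace V}) (f : V) (iota : V -> A) (chi1 chi2 : V -> K).

Hypothesis iotaD : forall x y, iota (x + y) = iota x + iota y.
Hypothesis iotaZ : forall c x, iota (c *: x) = algc c * iota x.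
Hypothesis chi2D : forall x y, chi2 (x + y) = chi2 x + chi2 y.
Hypothesis chi2Z : forall c x, chi2 (c *: x) = c * chi2 x.
Hypothesis chi12 : forall x, x \in m1 -> chi1 x = chi2 x.

Let k : {vspace V} := <[f]>%VS.
Let m2 : {vspace V} := (m1 + k)%VS.
Let I1 := shift_ideal m1 iota chi1.
Let I2 := shift_ideal m2 iota chi2.
Let inv1 := invariant m1 iota chi1.
Let inv2 := invariant m2 iota chi2.
Let c1 := @qhr_class K V A m1 iota chi1.
Let c2 := @qhr_class K V A m2 iota chi2.
Let comom (y : V) := c1 (iota y).
Let Ik := shift_ideal k comom chi2.
Let invk := invariant k comom chi2.
Let ck := @qhr_class K V _ k comom chi2.

Hypothesis inv1f : inv1 (iota f).
(** For J containing I1: m1-invariants lift along A/I1 -> A/J. *)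
Hypothesis lift1 : forall J : A -> Prop, left_ideal J ->
  forall u, (forall a, a \in m1 -> J (shift iota chi1 a * u)) ->
  exists2 v, J (u - v) & inv1 v.

Let s1 := shift iota chi1.
Let s2 := shift iota chi2.

Let Il1 : left_ideal I1. Proof. exact: shift_ideal_left. Qed.
Let Il2 : left_ideal I2. Proof. exact: shift_ideal_left. Qed.

Lemma shift2D x y : s2 (x + y) = s2 x + s2 y.
Proof. by rewrite /s2 /shift iotaD chi2D rmorphD opprD addrACA. Qed.

Lemma shift2Z c x : s2 (c *: x) = algc c * s2 x.
Proof. by rewrite /s2 /shift iotaZ chi2Z rmorphM mulrBr. Qed.

Lemma shift12 x : x \in m1 -> s1 x = s2 x.
Proof. by move=> xm; rewrite /s1 /s2 /shift chi12. Qed.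

Lemma inv1_shift y : y \in k -> inv1 (s2 y).
Proof.
move=> /vlineP[c ->]; rewrite shift2Z; apply: invariantM.
  exact: invariant_algc.
by apply: invariantB => //; exact: invariant_algc.
Qed.

Lemma stage_ideal_sub x : I1 x -> I2 x.
Proof.
apply: shift_ideal_min => // y ym; rewrite -/s1 shift12 //.
by apply/shift_ideal_gen/(subvP (addvSl _ _)).
Qed.

Lemma stage2_idealP x : I2 x <-> exists y, I1 (x - y * s2 f).
Proof.
split; last first.
  move=> [y Iy]; rewrite -(subrK (y * s2 f) x); apply: (left_idealD Il2).
    exact: stage_ideal_sub.
  apply/(left_idealM Il2)/shift_ideal_gen/(subvP (addvSr _ _)).
  exact: memv_line.
apply: (shift_ideal_min (D := fun x => exists y, I1 (x - y * s2 f)))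
  => [|z /memv_addP[z1 z1m [_ /vlineP[c ->] ->]]].
  split=> [|x1 x2 [y1 I1x] [y2 I2x]|a x1 [y1 I1x]].
  - by exists 0; rewrite mul0r subr0; apply: (left_ideal0 Il1).
  - exists (y1 + y2); rewrite mulrDl opprD addrACA; exact: (left_idealD Il1).
  - exists (a * y1); rewrite -mulrA -mulrBr; exact: (left_idealM Il1).
exists (algc c); rewrite -/s2 shift2D shift2Z addrK -shift12 //.
exact: shift_ideal_gen.
Qed.

Lemma class_shift y : y \in k -> shift comom chi2 y = c1 (s2 y).
Proof.
move=> yk; have iy : inv1 (iota y).
  move: yk => /vlineP[c ->]; rewrite iotaZ; apply: invariantM => //.
  exact: invariant_algc.
rewrite /s2 /shift /c1 qhr_classB //; last exact: invariant_algc.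
by rewrite qhr_class_algc.
Qed.

(** The two stages kill the same invariants.  If u = x s(f) modulo I1 is
    m1-invariant, x itself is only invariant modulo the kernel J of right
    multiplication by s(f), and lifting corrects it within J. *)
Lemma stage_idealP u : inv1 u -> (Ik (c1 u) <-> I2 u).
Proof.
move=> iu; split.
  pose D w := exists v, [/\ inv1 v, w = c1 v & I2 v].
  have Dl : left_ideal D.
    split=> [|w w' [v [iv -> Iv]] [v' [iv' -> Iv']]|w w' [v [iv -> Iv]]].
    - exists (algc 0); split; first exact: invariant_algc.
        by rewrite /c1 qhr_class_algc rmorph0.
      by rewrite rmorph0; apply: left_ideal0.
    - exists (v - (algc 0 - v')); rewrite /c1 !qhr_classB ?qhr_class_algc //;
        try by do ?apply: invariantB => //; apply: invariant_algc.
      split; rewrite ?rmorph0 ?sub0r ?opprK //.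
        have -> : v + v' = v - (algc 0 - v') by rewrite rmorph0 sub0r opprK.
        by do ?apply: invariantB => //; apply: invariant_algc.
      exact: (left_idealD Il2).
    have [x ix ->] := qhr_class_surj w; exists (x * v).
    split; [exact: invariantM|by rewrite /c1 qhr_classM|exact: (left_idealM Il2)].
  have Dgen y : y \in k -> D (shift comom chi2 y).
    move=> yk; exists (s2 y); split; [exact: inv1_shift|exact: class_shift|].
    exact/shift_ideal_gen/(subvP (addvSr _ _)).
  move=> /(shift_ideal_min Dl Dgen) [v [iv /(qhr_classP iu iv) Iuv Iv]].
  by rewrite -(subrK v u); apply: (left_idealD Il2) => //; exact: stage_ideal_sub.
move=> /stage2_idealP[x Ix].
(* J/I1 is the kernel of right multiplication by s(f) on A/I1. *)
pose J x := I1 (x * s2 f).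
have fk : f \in k by exact: memv_line.
have Jl : left_ideal J.
  split=> [|y z Jy Jz|a y Jy]; rewrite /J.
  - by rewrite mul0r; apply: (left_ideal0 Il1).
  - by rewrite mulrDl; apply: (left_idealD Il1).
  - by rewrite -mulrA; apply: (left_idealM Il1).
have [a am|v Jv iv] := lift1 Jl (u := x).
  rewrite /J -mulrA -[x * _](subKr u) mulrBr; apply: (left_idealB Il1).
    by move/invariantP: iu; apply.
  exact: (left_idealM Il1).
have iv2 : inv1 (v * s2 f) by apply: invariantM => //; exact: inv1_shift.
have -> : c1 u = c1 v * shift comom chi2 f.
  rewrite class_shift // /c1 -qhr_classM //; last exact: inv1_shift.
  apply/qhr_classP => //; rewrite -(subrKA (x * s2 f)) -mulrBl.
  exact: (left_idealD Il1).
exact/shift_idealMl/shift_ideal_gen.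
Qed.

(** k-invariance of the class of u says that s(y) u, again m1-invariant, vanishes
    in the second stage; so it is governed by the previous lemma. *)
Lemma stage_invariantP u : inv1 u -> (invk (c1 u) <-> inv2 u).
Proof.
move=> iu; have E y : y \in k -> (Ik (shift comom chi2 y * c1 u) <-> I2 (s2 y * u)).
  move=> yk; have iy := inv1_shift yk.
  rewrite class_shift // /c1 -qhr_classM //; apply: stage_idealP.
  exact: invariantM.
split=> [/invariantP H|/invariantP H]; apply/invariantP.
  move=> _ /memv_addP[z zm [y yk ->]]; rewrite -/s2 shift2D mulrDl.
  apply: (left_idealD Il2); last by apply/E => //; apply: H.
  by rewrite -shift12 //; apply: stage_ideal_sub; move/invariantP: iu; apply.
by move=> y yk; apply/E => //; apply: H; apply: (subvP (addvSr _ _)).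
Qed.

Lemma reduction_by_stages :
  exists phi : {rmorphism qhr k comom chi2 -> qhr m2 iota chi2},
    alg_iso phi /\ forall u, inv1 u -> invk (c1 u) ->
      inv2 u /\ phi (ck (c1 u)) = c2 u.
Proof.
pose R q w := exists u, [/\ inv1 u, invk (c1 u), q = ck (c1 u) & w = c2 u].
have [|||||||phi [phi_iso phiE]] := @alg_iso_of_rel K _ _ R.
- move=> q; have [w iw ->] := qhr_class_surj q.
  have [u iu Ew] := qhr_class_surj w; exists (c2 u), u.
  by rewrite /c1 -Ew.
- move=> w; have [u iu ->] := qhr_class_surj w.
  have [a am|v Juv iv] := lift1 Il2 (u := u).
    rewrite -/s1 shift12 //; move/invariantP: iu; apply.
    exact: (subvP (addvSl _ _)).
  have iv2 : inv2 v.
    rewrite -(subKr u v); apply: invariantB => //; exact: invariant_ideal.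
  exists (ck (c1 v)), v; split=> //; first exact/stage_invariantP.
  by apply/qhr_classP.
- move=> b [u [iu ik E ->]]; apply/qhr_class_eq0; first exact/stage_invariantP.
  by apply/stage_idealP => //; apply/(qhr_class_eq0 ik).
- move=> a [u [iu ik -> E]]; apply/qhr_class_eq0 => //.
  apply/stage_idealP => //; apply/qhr_class_eq0 => //; exact/stage_invariantP.
- move=> _ _ _ _ [u [iu ik -> ->]] [v [iv jk -> ->]]; exists (u - v).
  rewrite (qhr_classB iu iv : c1 (u - v) = c1 u - c1 v).
  rewrite (qhr_classB ik jk : ck (c1 u - c1 v) = ck (c1 u) - ck (c1 v)).
  split; [exact: invariantB|exact: (invariantB ik jk)|exact: erefl|].
  by apply/esym; apply: qhr_classB; apply/stage_invariantP.
- move=> _ _ _ _ [u [iu ik -> ->]] [v [iv jk -> ->]]; exists (u * v).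
  rewrite (qhr_classM iu iv : c1 (u * v) = c1 u * c1 v).
  rewrite (qhr_classM ik jk : ck (c1 u * c1 v) = ck (c1 u) * ck (c1 v)).
  split; [exact: invariantM|exact: (invariantM ik jk)|exact: erefl|].
  by apply/esym; apply: qhr_classM; apply/stage_invariantP.
- move=> c; exists (algc c); rewrite /c1 /c2 /ck !qhr_class_algc.
  by split=> //; exact: invariant_algc.
exists phi; split=> // u iu ik; split; first exact/stage_invariantP.
by apply: phiE; exists u.
Qed.

End Stages.

(** * The Lie algebra sl_n *)

Section Trace.
Variable K : fieldType.
Implicit Types U V : vectType K.

(** The trace underlying lfun_trace, for spaces that carry no bracket. *)
Definition end_trace V (f : 'End(V)) : K :=
  \tr (passmx.mxof (vbasis {:V}) (vbasis {:V}) f).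

(** Cyclicity between two different spaces makes the choice of bases immaterial. *)
Lemma end_traceC U V (f : 'Hom(U, V)) (h : 'Hom(V, U)) :
  end_trace (h \o f)%VF = end_trace (f \o h)%VF.
Proof.
rewrite /end_trace (passmx.mxof_comp _ _ (vbasisP _)).
by rewrite (passmx.mxof_comp _ _ (vbasisP _)) mxtrace_mulC.
Qed.

Lemma end_trace_linear V : linear (@end_trace V : 'End(V) -> K^o).
Proof. by move=> c f h; rewrite /end_trace passmx.mxof_linear linearP. Qed.

Lemma end_trace_sum V (I : Type) (r : seq I) (F : I -> 'End(V)) :
  end_trace (\sum_(i <- r) F i) = \sum_(i <- r) end_trace (F i).
Proof.
pose tr := GRing.isLinear.Build K _ _ _ _ (@end_trace_linear V).
pose T : {linear 'End(V) -> K^o} := HB.pack (@end_trace V) tr.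
exact: (raddf_sum T).
Qed.

Lemma end_traceZ V c (f : 'End(V)) : end_trace (c *: f) = c * end_trace f.
Proof.
pose tr := GRing.isLinear.Build K _ _ _ _ (@end_trace_linear V).
pose T : {linear 'End(V) -> K^o} := HB.pack (@end_trace V) tr.
exact: (linearZ_LR T c f).
Qed.

Lemma end_traceD V (f h : 'End(V)) : end_trace (f + h) = end_trace f + end_trace h.
Proof.
rewrite -{1}[f]scale1r [LHS]end_trace_linear; congr (_ + _); exact: mul1r.
Qed.

Lemma end_traceB V (f h : 'End(V)) : end_trace (f - h) = end_trace f - end_trace h.
Proof. by rewrite end_traceD -scaleN1r end_traceZ mulN1r. Qed.

Lemma linfun_exists (U V : vectType K) (f : U -> V) : linear f ->
  exists F : 'Hom(U, V), forall u, F u = f u.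
Proof.
move=> fl; pose F1 := GRing.isLinear.Build K U V _ f fl.
pose F2 : {linear U -> V} := HB.pack f F1.
by exists (linfun F2) => u; rewrite lfunE.
Qed.

(** A rank one map factors through the line K, where by cyclicity its trace is the
    scalar phi v. *)
Lemma end_trace_rank1 V (phi : V -> K) (v : V) (f : 'End(V)) :
  linear (phi : V -> K^o) -> (forall u, f u = phi u *: v) -> end_trace f = phi v.
Proof.
move=> /linfun_exists[p pE] fE.
have [|h hE] := @linfun_exists K^o V (fun c => c *: v).
  by move=> c a b; rewrite scalerDl scalerA.
have -> : f = (h \o p)%VF by apply/lfunP => u; rewrite comp_lfunE hE pE fE.
rewrite end_traceC (_ : (_ \o _)%VF = phi v *: \1%VF); last first.
  apply/lfunP => c; rewrite comp_lfunE scale_lfunE id_lfunE hE linearZ /= pE.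
  exact: mulrC.
rewrite end_traceZ /end_trace passmx.mxof1 ?(basis_free (vbasisP _)) //.
by rewrite mxtrace1 dimvf mulr1.
Qed.

End Trace.

Section LieTheory.
Variables (K : fieldType) (g : lieAlgType K).
Implicit Types x y z : g.

Lemma adE x y : ad x y = bracket x y.
Proof.
pose L := GRing.isLinear.Build K _ _ _ _ (bracketPr x).
pose L' : {linear g -> g} := HB.pack (bracket x) L.
exact: (lfunE L').
Qed.

Lemma bracketDr x y z : bracket x (y + z) = bracket x y + bracket x z.
Proof. by rewrite -!adE linearD. Qed.

Lemma bracketZr c x y : bracket x (c *: y) = c *: bracket x y.
Proof. by rewrite -!adE linearZ. Qed.

Lemma bracket0r x : bracket x 0 = 0.
Proof. by rewrite -adE linear0. Qed.

Lemma bracket_sumr x (I : Type) (r : seq I) (P : pred I) (h : I -> g) :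
  bracket x (\sum_(i <- r | P i) h i) = \sum_(i <- r | P i) bracket x (h i).
Proof. by rewrite -adE linear_sum; apply: eq_bigr => i _; rewrite /= adE. Qed.

Lemma bracketDl x y z : bracket (x + y) z = bracket x z + bracket y z.
Proof. by have := bracketPl z 1 x y; rewrite /= !scale1r. Qed.

Lemma bracketC x y : bracket x y = - bracket y x.
Proof.
apply/eqP; rewrite -addr_eq0; apply/eqP.
by have := bracketxx (x + y); rewrite bracketDl !bracketDr !bracketxx add0r addr0.
Qed.

Lemma bracket0l x : bracket 0 x = 0.
Proof. by rewrite bracketC bracket0r oppr0. Qed.

Lemma bracketZl c x y : bracket (c *: x) y = c *: bracket x y.
Proof. by rewrite bracketC bracketZr -scalerN -bracketC. Qed.

Lemma bracketNl x y : bracket (- x) y = - bracket x y.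
Proof. by rewrite -scaleN1r bracketZl scaleN1r. Qed.

Lemma bracketNr x y : bracket x (- y) = - bracket x y.
Proof. by rewrite -scaleN1r bracketZr scaleN1r. Qed.

Lemma ad_linear : linear (@ad K g).
Proof.
by move=> c x y; apply/lfunP => z; rewrite [RHS]add_lfunE scale_lfunE !adE bracketDl bracketZl.
Qed.

Lemma ad_bracket x y : ad (bracket x y) = ((ad x \o ad y) - (ad y \o ad x))%VF.
Proof.
apply/lfunP => z; rewrite [RHS]add_lfunE opp_lfunE !comp_lfunE !adE.
have /eqP := jacobi x y z; rewrite (bracketC z (bracket x y)) subr_eq0 => /eqP <-.
by congr (_ + _); rewrite (bracketC z x) -scaleN1r bracketZr scaleN1r.
Qed.

End LieTheory.

Section SlProj.
Variables (K : numFieldType) (n : nat).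
Hypothesis n0 : (0 < n)%N.
Implicit Types (A B : 'M[K]_n) (x y z : sl K n).

(** The projection of gl_n onto sl_n along the scalar matrices; it preserves
    commutators, so that the matrix units of gl_n can be used inside sl_n. *)
Definition slp A : sl K n := vsproj (sl_space K n) (A - (\tr A / n%:R)%:M).

Lemma sl_valP (x y : sl K n) : vsval x = vsval y -> x = y.
Proof. exact: val_inj. Qed.

Lemma val_slp A : vsval (slp A) = A - (\tr A / n%:R)%:M.
Proof.
apply: vsprojK; rewrite mem_sl_space linearB /= mxtrace_scalar -[_ *+ n]mulr_natr.
have nn : n%:R != 0 :> K by rewrite pnatr_eq0 -lt0n.
by rewrite divfK ?subrr.
Qed.

Lemma val_slp0 A : \tr A = 0 -> vsval (slp A) = A.
Proof. by move=> A0; rewrite val_slp A0 mul0r raddf0 subr0. Qed.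

Lemma tr_val x : \tr (vsval x) = 0.
Proof. by apply/eqP; rewrite -mem_sl_space subvsP. Qed.

Lemma slpK x : slp (vsval x) = x.
Proof. by apply: sl_valP; rewrite val_slp0 ?tr_val. Qed.

Lemma vsvalP (c : K) x y : vsval (c *: x + y) = c *: vsval x + vsval y.
Proof. exact: linearP. Qed.

Lemma vsvalZ (c : K) x : vsval (c *: x) = c *: vsval x.
Proof. exact: linearZ. Qed.

Lemma vsvalD x y : vsval (x + y) = vsval x + vsval y.
Proof. exact: linearD. Qed.

Lemma vsvalB x y : vsval (x - y) = vsval x - vsval y.
Proof. exact: linearB. Qed.

Lemma vsval0 : vsval (0 : sl K n) = 0.
Proof. exact: linear0. Qed.

Lemma sl_eq0 (x : sl K n) : (forall k l, vsval x k l = 0) -> x = 0.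
Proof.
by move=> x0; apply: sl_valP; apply/matrixP => k l; rewrite vsval0 mxE x0.
Qed.

Lemma vsval_sum (I : Type) (r : seq I) (F : I -> sl K n) k l :
  vsval (\sum_(i <- r) F i) k l = \sum_(i <- r) vsval (F i) k l.
Proof.
elim: r => [|i r IHr]; first by rewrite !big_nil vsval0 mxE.
by rewrite !big_cons vsvalD mxE IHr.
Qed.

Lemma slp_linear : linear slp.
Proof.
move=> c A B; apply: sl_valP; rewrite vsvalP !val_slp mxtraceD mxtraceZ.
rewrite mulrDl -mulrA; move: (_ / _) (_ / _) => a b.
by apply/matrixP => i j; rewrite !mxE; case: (i == j); rewrite ?mulr1n ?mulr0n; ring.
Qed.
HB.instance Definition _ := GRing.isLinear.Build K 'M[K]_n (sl K n) _ slp slp_linear.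

Lemma val_bracket x y :
  vsval (bracket x y) = vsval x *m vsval y - vsval y *m vsval x.
Proof. by []. Qed.

Lemma tr_commutator A B : \tr (A *m B - B *m A) = 0.
Proof. by rewrite linearB /= mxtrace_mulC subrr. Qed.

Lemma bracket_slp A B : bracket (slp A) (slp B) = slp (A *m B - B *m A).
Proof.
apply: sl_valP; rewrite val_bracket [RHS]val_slp0 ?tr_commutator // !val_slp.
rewrite !(mulmxBl, mulmxBr) !(mul_scalar_mx, mul_mx_scalar).
move: (_ / _) (_ / _) (A *m B) (B *m A) => a b C D.
by apply/matrixP => i j; rewrite !mxE; case: (i == j); rewrite ?mulr1n ?mulr0n; ring.
Qed.

Definition slE (i j : 'I_n) : sl K n := slp (delta_mx i j).

Lemma val_slE (k l : 'I_n) : k != l -> vsval (slE k l) = delta_mx k l.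
Proof.
move=> kl; rewrite val_slp0 // /mxtrace big1 // => i _; rewrite mxE.
by case: (eqVneq i k) => //= ->; rewrite (negPf kl).
Qed.

Lemma slE_bracket i j k l :
  bracket (slE i j) (slE k l) = (j == k)%:R *: slE i l - (l == i)%:R *: slE k j.
Proof.
rewrite /slE bracket_slp linearB /=; congr (_ - _).
  case: eqVneq => [->|/negPf jk]; rewrite ?mul_delta_mx ?scale1r //.
  by rewrite mul_delta_mx_0 ?jk // linear0 scale0r.
case: eqVneq => [->|/negPf jk]; rewrite ?mul_delta_mx ?scale1r //.
by rewrite mul_delta_mx_0 ?jk // linear0 scale0r.
Qed.

Lemma slE_sum x : x = \sum_i \sum_j vsval x i j *: slE i j.
Proof.
rewrite -[LHS]slpK [X in slp X]matrix_sum_delta linear_sum; apply: eq_bigr => i _.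
by rewrite linear_sum; apply: eq_bigr => j _; rewrite linearZ.
Qed.

(** ad x ad y is the sum of the rank one maps z |-> z_ij [x, [y, E_ij]], so its trace
    is the sum of the (i,j) entries of the brackets [x, [y, E_ij]]. *)
Lemma killingE x y : killing x y = (2 * n)%:R * \tr (vsval x *m vsval y).
Proof.
rewrite /killing -[lfun_trace _]/(end_trace _).
pose phi i j z : K := vsval (z : sl K n) i j.
have phi_lin i j : linear (phi i j : sl K n -> K^o).
  by move=> c u v; rewrite /phi vsvalP !mxE.
pose v i j : sl K n := bracket x (bracket y (slE i j)).
have ex i j : exists F : 'End(sl K n), forall z, F z = phi i j z *: v i j.
  apply: linfun_exists => c a b; rewrite phi_lin scalerDl.
  by rewrite -scalerA.
pose F i j := projT1 (cid (ex i j)).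
have FE i j z : F i j z = phi i j z *: v i j by rewrite /F; case: cid.
have -> : (ad x \o ad y)%VF = \sum_i \sum_j F i j.
  apply/lfunP => z; rewrite comp_lfunE !adE {1}[z]slE_sum !bracket_sumr sum_lfunE.
  apply: eq_bigr => i _; rewrite !bracket_sumr sum_lfunE; apply: eq_bigr => j _.
  by rewrite !bracketZr FE.
rewrite end_trace_sum.
transitivity (\sum_i \sum_j phi i j (v i j)).
  apply: eq_bigr => i _; rewrite end_trace_sum; apply: eq_bigr => j _.
  exact: end_trace_rank1 (phi_lin i j) (FE i j).
pose X := vsval x; pose Y := vsval y.
have vE i j : vsval (v i j) = X *m (Y *m delta_mx i j) + delta_mx i j *m (Y *m X)
   - (X *m delta_mx i j *m Y + Y *m (delta_mx i j *m X)).
  have -> : v i j = bracket x (slp (Y *m delta_mx i j - delta_mx i j *m Y)).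
    by rewrite /v -[y in LHS]slpK bracket_slp.
  rewrite val_bracket val_slp0 ?tr_commutator // -/X mulmxBr mulmxBl !mulmxA.
  by rewrite opprB opprD addrACA addrA.
have delta_l (A : 'M[K]_n) i j k l : (A *m delta_mx i j) k l = A k i * (j == l)%:R.
  rewrite mxE (bigD1 i) //= big1 ?addr0 => [|p /negPf pi]; rewrite !mxE ?eqxx ?pi ?mulr0 //.
  by rewrite eq_sym.
have delta_r (A : 'M[K]_n) i j k l : (delta_mx i j *m A) k l = (k == i)%:R * A j l.
  rewrite mxE (bigD1 j) //= big1 ?addr0 => [|p /negPf pi]; rewrite !mxE ?eqxx ?pi ?andbT //.
  by rewrite andbF mul0r.
have delta_lr (A B : 'M[K]_n) i j k l : (A *m delta_mx i j *m B) k l = A k i * B j l.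
  rewrite mxE (bigD1 j) //= big1 ?addr0 => [|p /negPf pj].
    by rewrite delta_l eqxx mulr1.
  by rewrite delta_l eq_sym pj mulr0 mul0r.
have phiE i j : phi i j (v i j) =
    (X *m Y) i i + (Y *m X) j j - (X i i * Y j j + Y i i * X j j).
  have E (A B C D : 'M[K]_n) : (A + B - (C + D)) i j = A i j + B i j - (C i j + D i j).
    by rewrite !mxE.
  by rewrite /phi vE E !mulmxA !delta_lr delta_l -mulmxA delta_r !eqxx mul1r mulr1.
have dbl (F1 F2 : 'I_n -> K) : \sum_i \sum_j F1 i * F2 j = (\sum_i F1 i) * \sum_j F2 j.
  by rewrite mulr_suml; apply: eq_bigr => i _; rewrite mulr_sumr.
under eq_bigr => i _ do under eq_bigr => j _ do rewrite phiE.
under eq_bigr => i _ do rewrite sumrB !big_split /= sumr_const card_ord.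
rewrite sumrB !big_split /= !dbl sumr_const card_ord.
have -> : \sum_i X i i = 0 by exact: tr_val.
have -> : \sum_i Y i i = 0 by exact: tr_val.
rewrite !mul0r addr0 subr0 sumrMnl -/(\tr (X *m Y)) -/(\tr (Y *m X)).
by rewrite mxtrace_mulC -mulrnDl -mulr2n -mulrnA mulr_natl.
Qed.

Lemma mxtrace_mul (A B : 'M[K]_n) : \tr (A *m B) = \sum_k \sum_l A k l * B l k.
Proof. by apply: eq_bigr => k _; rewrite mxE. Qed.

Lemma killing_eq0 (e x : sl K n) :
  (forall k l, vsval e k l * vsval x l k = 0) -> killing e x = 0.
Proof.
move=> ex; rewrite killingE // mxtrace_mul big1 ?mulr0 // => k _.
by rewrite big1 // => l _; apply: ex.
Qed.

Lemma tr_mul_delta (A : 'M[K]_n) i j : \tr (A *m delta_mx i j) = A j i.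
Proof.
rewrite mxtrace_mul (bigD1 j) //= (bigD1 i) //= mxE !eqxx mulr1 big1 ?addr0 => [|k /negPf ki].
  rewrite big1 ?addr0 // => k /negPf kj; rewrite big1 // => l _.
  by rewrite mxE kj andbF mulr0.
by rewrite mxE ki mulr0.
Qed.

Lemma tr_mul_slE (x : sl K n) i j : \tr (vsval x *m vsval (slE i j)) = vsval x j i.
Proof.
by rewrite val_slp // mulmxBr mul_mx_scalar linearB /= mxtraceZ tr_val mulr0 subr0 tr_mul_delta.
Qed.

Lemma killing_slE (e : sl K n) k l :
  killing e (slE k l) = (2 * n)%:R * vsval e l k.
Proof. by rewrite killingE // tr_mul_slE. Qed.

Lemma val_sl_unitsE (P : rel 'I_n) k l : irreflexive P ->
  vsval (sl_units K P) k l = (P k l)%:R.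
Proof.
move=> irrP; rewrite val_sl_units // summxE.
transitivity (\sum_i \sum_(j | P i j) ((k == i) && (l == j))%:R : K).
  by apply: eq_bigr => i _; rewrite summxE; apply: eq_bigr => j _; rewrite mxE.
rewrite (bigD1 k) //= [X in _ + X]big1 ?addr0 => [|i /negPf ik]; last first.
  by rewrite big1 // => j _; rewrite eq_sym ik.
have [Pkl|/negPf Pkl] := boolP (P k l).
  rewrite (bigD1 l) //= !eqxx big1 ?addr0 // => j /andP[_ /negPf jl].
  by rewrite eq_sym jl.
rewrite big1 // => j Pkj; rewrite eqxx /=.
by case: (eqVneq l j) Pkj => [<-|]; rewrite ?Pkl.
Qed.

End SlProj.

(** * The pyramid of shape (n-1, 1) *)

Section PyramidPieces.
Variables (K : numFieldType) (n : nat) (mu : seq nat).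

Definition supported_on (S : rel 'I_n) (x : sl K n) :=
  forall k l, vsval x k l != 0 -> S k l.

Lemma mem_units (S : pred ('I_n * 'I_n)) (A : 'M[K]_n) :
  A \in span [seq delta_mx p.1 p.2 | p <- enum {: 'I_n * 'I_n} & S p] <->
  forall k l, A k l != 0 -> S (k, l).
Proof.
split=> [|SA]; last first.
  rewrite [A]matrix_sum_delta; apply: memv_suml => i _; apply: memv_suml => j _.
  have [->|/SA Sij] := eqVneq (A i j) 0; first by rewrite scale0r mem0v.
  apply/memvZ/memv_span/mapP; exists (i, j) => //.
  by rewrite mem_filter Sij mem_enum.
move=> Aspan k l; apply: contraR => nS.
have lin : linear (fun A : 'M[K]_n => A k l : K^o) by move=> c B C; rewrite !mxE.
have [F FE] := linfun_exists lin.
have: A \in lker F.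
  apply: (subvP _ _ Aspan); apply/span_subvP => B /mapP[[i j] /=].
  rewrite mem_filter => /andP[Sij _] ->; rewrite memv_ker FE mxE.
  case: (eqVneq k i) => //= ki; case: (eqVneq l j) => //= lj.
  by move: nS; rewrite ki lj Sij.
by rewrite memv_ker FE => /eqP ->.
Qed.

Lemma mem_pyr_piece d (x : sl K n) :
  x \in pyr_piece K n mu d <-> supported_on (fun k l => pyr_deg mu k l == d) x.
Proof.
rewrite /pyr_piece -memv_preim lfunE /units_of_deg.
exact: (@mem_units (fun p => pyr_deg mu p.1 p.2 == d)).
Qed.

End PyramidPieces.

Section SubregularPyramid.
Variables (K : numFieldType) (m : nat).
Local Notation n := m.+2.
Local Notation mu := [:: m.+1; 1%N].

Lemma subregular_boxes : boxes mu = [seq (1, c)%N | c <- iota 0 m.+1] ++ [:: (2, m)%N].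
Proof.
rewrite /boxes [head _ _]/=.
have -> : iota 0 m.+1 = iota 0 m ++ [:: m] by rewrite -addn1 iotaD.
rewrite !map_cat flatten_cat /= subnn subn1 leqnn /= -catA; congr (_ ++ _).
have: all (fun c => c < m)%N (iota 0 m) by apply/allP => c; rewrite mem_iota.
elim: (iota 0 m) => //= c s IHs /andP[cm /IHs sm].
by rewrite [(m <= c)%N]leqNgt cm /= sm.
Qed.

Lemma row_ofE (k : 'I_n) : row_of mu k = (if k < m.+1 then 1 else 2)%N.
Proof.
rewrite /row_of subregular_boxes nth_cat size_map size_iota.
case: ltnP => km; first by rewrite (nth_map 0%N) ?size_iota.
by have -> : (k - m.+1 = 0)%N by have := ltn_ord k; lia.
Qed.

Lemma col_ofE (k : 'I_n) : col_of mu k = (minn k m * 2)%N.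
Proof.
rewrite /col_of subregular_boxes nth_cat size_map size_iota; congr (Posz (_ * 2)).
case: ltnP => km; first by rewrite (nth_map 0%N) ?size_iota // nth_iota // (minn_idPl _).
have -> : (k - m.+1 = 0)%N by have := ltn_ord k; lia.
by rewrite /= (minn_idPr _) // ltnW.
Qed.

(** The last two boxes share a column, whence the truncation by m: among
    the strictly lower triangular positions, m_1 misses exactly that of f. *)
Lemma mem_pyr_m1 (x : sl K n) :
  x \in pyr_m1 K n mu <-> supported_on (fun k l => minn l m < minn k m)%N x.
Proof.
split=> [|xS].
  have lin k l : linear (fun y : sl K n => vsval y k l : K^o).
    by move=> c y z; rewrite vsvalP !mxE.
  move=> xm k l; apply: contraR => nS; have [F FE] := linfun_exists (lin k l).
  suff: (pyr_m1 K n mu <= lker F)%VS.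
    by move/subvP/(_ x xm); rewrite memv_ker FE => /eqP ->.
  rewrite /pyr_m1 big_seq_cond; apply: (big_ind (fun U => U <= lker F)%VS) => [|U V UF VF|d].
  - exact: sub0v.
  - by rewrite subv_add UF.
  move=> /andP[_ d2]; apply/subvP => y /mem_pyr_piece yd.
  rewrite memv_ker FE; apply: contraR nS => /yd /eqP.
  rewrite /pyr_deg !col_ofE; lia.
rewrite [x]slE_sum //; apply: memv_suml => i _; apply: memv_suml => j _.
have [->|/xS Sij] := eqVneq (vsval x i j) 0; first by rewrite scale0r mem0v.
apply: memvZ; set d := pyr_deg mu i j.
have d2 : (d <= -2)%R by rewrite /d /pyr_deg !col_ofE; lia.
have ij : i != j by apply: contraTneq Sij => ->; rewrite ltnn.
have dd : d \in pyr_degrees n mu.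
  by rewrite mem_undup; apply/mapP; exists (i, j); rewrite ?mem_enum.
rewrite /pyr_m1 (big_rem d) //= d2.
apply: (subvP (addvSl _ _)); apply/mem_pyr_piece => k l.
rewrite val_slp0 //; last first.
  rewrite /mxtrace big1 // => p _; rewrite mxE; case: (eqVneq p i) => // ->.
  by rewrite (negbTE ij).
by rewrite mxE; case: (eqVneq k i) => [->|_]; case: (eqVneq l j) => [->|_] /=; rewrite ?eqxx.
Qed.

Lemma val_e1 (k l : 'I_n) :
  vsval (pyr_e1 K n mu) k l = ((l == k.+1 :> nat) && (k < m)%N)%:R.
Proof.
have E i j : arrow (n := n) mu i j = (j == i.+1 :> nat) && (i < m)%N.
  rewrite /arrow !row_ofE !col_ofE.
  have := ltn_ord i; have := ltn_ord j.
  case: (ltnP i m.+1); case: (ltnP j m.+1); lia.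
by rewrite val_sl_unitsE ?E // => i; rewrite E; lia.
Qed.

Lemma val_e2 (k l : 'I_n) :
  vsval (pyr_e2 K n mu 1 2) k l = (l == k.+1 :> nat)%:R.
Proof.
rewrite vsvalD mxE val_e1.
have E i j : [&& row_of (n := n) mu i == 1%N, row_of (n := n) mu j == 2 &
    col_of (n := n) mu i == col_of (n := n) mu j] = (i == m :> nat) && (j == m.+1 :> nat).
  rewrite !row_ofE !col_ofE.
  have := ltn_ord i; have := ltn_ord j.
  case: (ltnP i m.+1); case: (ltnP j m.+1); lia.
rewrite val_sl_unitsE => [|i]; rewrite E; last by lia.
rewrite -natrD; congr (_%:R); have := ltn_ord l; have := ltn_ord k.
by case: eqP; case: ltnP; case: eqP; case: eqP; lia.
Qed.

Local Notation f := (pyr_E K n mu 1 2 1).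

Lemma val_f (k l : 'I_n) :
  vsval f k l = ((k == m.+1 :> nat) && (l == m :> nat))%:R.
Proof.
have E (i j : 'I_n) : [&& 1 <= row_of mu j, row_of mu j < row_of mu i,
   row_of mu i <= 2, row_of mu i - row_of mu j == 1 & col_of mu j == col_of mu i]%N
   = (i == m.+1 :> nat) && (j == m :> nat).
  rewrite !row_ofE !col_ofE.
  have := ltn_ord i; have := ltn_ord j.
  case: (ltnP i m.+1); case: (ltnP j m.+1); lia.
by rewrite val_sl_unitsE => [|i]; rewrite E //; lia.
Qed.

Lemma pyr_kE : pyr_k K n mu 1 2 = <[f]>%VS.
Proof. by rewrite /pyr_k /= span_seq1. Qed.

Lemma mem_pyr_m2 (x : sl K n) :
  x \in pyr_m2 K n mu 1 2 <-> supported_on (fun k l => l < k)%N x.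
Proof.
rewrite /pyr_m2 pyr_kE; split.
  move=> /memv_addP[y /mem_pyr_m1 ym [_ /vlineP[c ->] ->]] k l.
  rewrite vsvalD vsvalZ !mxE val_f; apply: contraR => kl.
  have [-> | /ym] := eqVneq (vsval y k l) 0; last by lia.
  rewrite add0r; have -> : (k == m.+1 :> nat) && (l == m :> nat) = false by lia.
  by rewrite mulr0.
move=> xS; pose c := vsval x (inord m.+1) (inord m).
rewrite -(subrK (c *: f) x); apply: memv_add; last exact/memvZ/memv_line.
apply/mem_pyr_m1 => k l; rewrite vsvalB vsvalZ 3!mxE val_f; apply: contraR => kl.
have [/andP[/eqP km /eqP lm]|] := boolP ((k == m.+1 :> nat) && (l == m :> nat)).
  have -> : k = inord m.+1 by apply: val_inj; rewrite /= inordK.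
  have -> : l = inord m by apply: val_inj; rewrite /= inordK // ltnW.
  by rewrite mulr1 subrr eqxx.
move=> kl'; rewrite mulr0 subr0; apply: contraT => /xS; have := ltn_ord k; lia.
Qed.

(** e_2 - e_1 pairs only with the matrix unit f, which does not occur in m_1. *)
Lemma killing_e1_e2 x : x \in pyr_m1 K n mu ->
  killing (pyr_e1 K n mu) x = killing (pyr_e2 K n mu 1 2) x.
Proof.
move=> /mem_pyr_m1 xm; rewrite !killingE // !mxtrace_mul; congr (_ * _).
apply: eq_bigr => k _; apply: eq_bigr => l _; rewrite val_e1 val_e2.
have [->|/xm kl] := eqVneq (vsval x l k) 0; first by rewrite !mulr0.
congr (_%:R * _); have := ltn_ord l; lia.
Qed.

End SubregularPyramid.

(** * Slices for the subregular reduction *)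

Section CentralShift.
Variables (K : comNzRingType) (A : pzAlgType K).
Implicit Types (x y : A).

Lemma commutator_subl x y c : commutator (x - algc c) y = commutator x y.
Proof. by rewrite /commutator mulrBl mulrBr algc_central opprB addrA subrK. Qed.

Lemma commutator_subr x y c : commutator x (y - algc c) = commutator x y.
Proof. by rewrite /commutator mulrBl mulrBr algc_central opprB addrA subrK. Qed.

End CentralShift.

Section ShiftTheory.
Variables (K : fieldType) (g : lieAlgType K) (e : g).
Local Notation s := (shift (@uea_in K g) (killing e)).
Implicit Types x y : g.

Lemma commutator_uea_in x y : commutator (uea_in x) (uea_in y) = uea_in (bracket x y).
Proof. exact/esym/uea_in_bracket. Qed.

Lemma shift_commutator_in x y : commutator (s x) (uea_in y) = uea_in (bracket x y).
Proof. by rewrite /shift commutator_subl commutator_uea_in. Qed.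

Lemma shift_commutator x y : commutator (s x) (s y) = uea_in (bracket x y).
Proof. by rewrite {2}/shift commutator_subr shift_commutator_in. Qed.

End ShiftTheory.

Section SubregularSlices.
Variables (K : numFieldType) (m : nat).
Local Notation n := m.+2.
Local Notation mu := [:: m.+1; 1%N].
Local Notation e1 := (pyr_e1 K n mu).
Local Notation E := (slE K).
Local Notation s := (shift (@uea_in K (sl K n)) (killing e1)).
Local Notation I1 := (shift_ideal (pyr_m1 K n mu) (@uea_in K (sl K n)) (killing e1)).

(** The matrix unit E_(k,c) is listed at position c n + k, so that positions are
    ordered by columns; a position is active if it lies below the diagonal, and
    the active positions before m n enumerate a basis of m_1. *)
Let colN N : 'I_n := inord (N %/ n).
Let rowN N : 'I_n := inord (N %% n).
Let act N := (N %/ n < N %% n)%N.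
Let a N := s (E (rowN N) (colN N)).

Lemma killing_e1 (k l : 'I_n) :
  killing e1 (E k l) = ((2 * n) * ((k == l.+1 :> nat) && (l < m)%N))%:R.
Proof. by rewrite killing_slE // val_e1 -natrM. Qed.

Let rowNE N : rowN N = (N %% n)%N :> nat.
Proof. by rewrite inordK // ltn_mod. Qed.

Let colNE N : (N < m * n)%N -> (colN N = (N %/ n)%N :> nat) * (colN N < m)%N.
Proof.
move=> NM; have H : (N %/ n < m)%N by rewrite ltn_divLR.
have H2 : (N %/ n < n)%N by apply: (leq_trans H); rewrite -addn2 leq_addr.
by split; rewrite /colN inordK.
Qed.

Let indexE (c k : 'I_n) (N := (c * n + k)%N) : (rowN N = k) * (colN N = c).
Proof.
have H : (N %% n = k)%N by rewrite /N modnMDl modn_small.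
have H' : (N %/ n = c)%N by rewrite /N divnMDl // divn_small // addn0.
by split; apply: val_inj; rewrite /= inordK ?H ?H'.
Qed.

Let ltN N (c k : 'I_n) : (N < m * n)%N ->
  ((c * n + k < N) = (c < colN N) || ((c == colN N) && (k < rowN N)))%N.
Proof.
move=> NM; rewrite {1}(divn_eq N n) -(rowNE N) -(colNE NM).1.
move: (colN N) (rowN N) => c' k'; have := ltn_ord k; have := ltn_ord k'.
rewrite -val_eqE /=.
case: (ltngtP c c') => [cc|cc|->] /=; rewrite ?ltn_add2l // => k'n kn.
  have : (c.+1 * n <= c' * n)%N by rewrite leq_mul2r cc orbT.
  by rewrite mulSn; lia.
have : (c'.+1 * n <= c * n)%N by rewrite leq_mul2r cc orbT.
by rewrite mulSn; lia.
Qed.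

Lemma below_gen N (c k : 'I_n) : (N < m * n)%N -> (c < k)%N ->
  (c < colN N)%N || ((c == colN N) && (k < rowN N)%N) ->
  comb_below a act N (s (E k c)).
Proof.
move=> NM ck; rewrite -(ltN _ _ NM) => lt D Dl Da.
have := Da _ lt; rewrite /a !indexE; apply.
rewrite /act.
by rewrite divnMDl // divn_small // addn0 modnMDl modn_small.
Qed.

Lemma belowN N u : comb_below a act N u -> comb_below a act N (- u).
Proof. by move=> uN D Dl Da; apply: (left_idealN Dl); apply: uN. Qed.

Lemma below0 N : comb_below a act N 0.
Proof. by move=> D Dl _; apply: left_ideal0. Qed.

Lemma shift_e1_eq (k l : 'I_n) : (k == l.+1 :> nat) = false ->
  uea_in (E k l) = s (E k l).
Proof. by move=> kl1; rewrite /shift killing_e1 // kl1 muln0 rmorph0 subr0. Qed.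

Let act_lt N : (N < m * n)%N -> act N = (colN N < rowN N)%N.
Proof. by move=> NM; rewrite (colNE NM) rowNE. Qed.

Let aE N : a N = s (E (rowN N) (colN N)). Proof. by []. Qed.

(** [E_(k',c'), E_(k,c)] with c' <= c can only be - E_(k,c') with c' < c, on which
    the character vanishes because it lies below the first subdiagonal. *)
Lemma columns_commute N k : (N < m * n)%N -> act N -> (k < N)%N -> act k ->
  comb_below a act N (commutator (a k) (a N)).
Proof.
move=> NM aN kN ak; have kM := ltn_trans kN NM.
have [_ cm] := colNE NM; have [_ c'm] := colNE kM.
have := aN; have := ak; rewrite !act_lt // => cr' cr.
have lt : (colN k < colN N)%N || ((colN k == colN N) && (rowN k < rowN N)%N).
  by rewrite -ltN // (rowNE k) (colNE kM).1 -divn_eq.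
rewrite !aE shift_commutator slE_bracket //.
have -> : (colN k == rowN N) = false by apply/eqP => H; move: lt; rewrite H -val_eqE /=; lia.
rewrite scale0r sub0r uea_inN; apply: belowN.
have [crE|_] := eqVneq (colN N) (rowN k); last first.
  by rewrite scale0r uea_in0; apply: below0.
have c'c : (colN k < colN N)%N by rewrite crE.
rewrite scale1r shift_e1_eq; last by lia.
by apply: below_gen => //; rewrite ?c'c //; lia.
Qed.

(** The slice of E_(k,c) is E_(c+1,k): their bracket is - E_(c+1,c), on which the
    character is 2n.  Bracketing with the earlier units gives 0 or - E_(c+1,c')
    with c' < c, an earlier unit on which the character vanishes. *)
Lemma column_slices N : (N < m * n)%N -> act N -> exists b kappa eps,
  [/\ kappa != 0,
      forall k, (k < N)%N -> act k -> comb_below a act N (commutator (a k) b)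
    & comb_below a act N (commutator (a N) b + algc kappa + algc eps * a N)].
Proof.
move=> NM aN; have [_ cm] := colNE NM; have cr := aN; rewrite act_lt // in cr.
pose p : 'I_n := inord (colN N).+1.
have pE : p = (colN N).+1 :> nat by rewrite inordK //; lia.
pose q := rowN N.
exists (uea_in (E p q)), ((2 * n)%:R), (p == q)%:R; split.
- by rewrite pnatr_eq0 muln_eq0.
- move=> k kN ak; have kM := ltn_trans kN NM.
  have [_ c'm] := colNE kM; have cr' := ak; rewrite act_lt // in cr'.
  have lt : (colN k < colN N)%N || ((colN k == colN N) && (rowN k < rowN N)%N).
    by rewrite -ltN // (rowNE k) (colNE kM).1 -divn_eq.
  rewrite aE shift_commutator_in slE_bracket //.
  have -> : (colN k == p) = false.
    by rewrite -val_eqE /= pE; move: lt; rewrite -val_eqE /=; lia.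
  rewrite scale0r sub0r uea_inN; apply: belowN.
  have [qk|_] := eqVneq q (rowN k); last by rewrite scale0r uea_in0; apply: below0.
  have c'c : (colN k < colN N)%N by move: lt; rewrite -qk ltnn andbF orbF.
  rewrite scale1r shift_e1_eq; last by rewrite pE; lia.
  by apply: below_gen => //; rewrite ?c'c // pE; lia.
have pc : p != colN N by rewrite -val_eqE /= pE; lia.
rewrite aE shift_commutator_in slE_bracket // eqxx scale1r eq_sym (negbTE pc).
rewrite scale0r sub0r uea_inN.
have sz : s (E p (colN N)) = uea_in (E p (colN N)) - algc (2 * n)%:R.
  have kE : killing e1 (E p (colN N)) = (2 * n)%:R.
    by rewrite killing_e1 pE eqxx cm muln1.
  by rewrite /shift kE.
have oppBC (A : zmodType) (x y : A) : - x + y = - (x - y) by rewrite opprB addrC.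
have -> : - uea_in (E p (colN N)) + algc (2 * n)%:R = - s (E p (colN N)).
  by rewrite sz oppBC.
have [pq|pq] := eqVneq p q.
  rewrite -/q -pq.
  have addN1 (A : pzAlgType K) (x : A) : - x + algc 1 * x = 0.
    by rewrite rmorph1 mul1r addNr.
  rewrite [X in comb_below _ _ _ X](addN1 _ (s (E p (colN N)))).
  exact: below0.
have add0 (A : pzAlgType K) (x y : A) : - x + algc 0 * y = - x.
  by rewrite rmorph0 mul0r addr0.
rewrite [X in comb_below _ _ _ X]add0.
have pq' : (colN N < colN N)%N || ((colN N == colN N) && (p < rowN N)%N).
  rewrite ltnn eqxx /= -/q; move: pq cr; rewrite -val_eqE /= pE -/q; lia.
have cp : (colN N < p)%N by rewrite pE.
apply: belowN; exact: (below_gen NM cp pq').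
Qed.

Lemma ad3_slE (k c : 'I_n) x : k != c ->
  bracket (E k c) (bracket (E k c) (bracket (E k c) x)) = 0.
Proof.
move=> kc; apply: sl_valP; rewrite !val_bracket val_slE // vsval0.
have D2 : delta_mx k c *m delta_mx k c = 0 :> 'M[K]_n by rewrite mul_delta_mx_0 // eq_sym.
move: (vsval x) => X; set D := delta_mx _ _ in D2 *.
rewrite !(mulmxBr, mulmxBl) !mulmxA D2 !mul0mx.
by rewrite -!mulmxA D2 !mulmx0 !(subr0, sub0r, oppr0).
Qed.

(** s kills 1 modulo I1, and ad E_(k,c) is nilpotent of order 3 on g, so powers of s
    kill every word in g. *)
Lemma slE_locally_nilpotent (k c : 'I_n) : (c < k)%N -> E k c \in pyr_m1 K n mu ->
  forall x, exists N, I1 (s (E k c) ^+ N * x).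
Proof.
move=> ck Em x; have kc : k != c by rewrite -val_eqE /=; lia.
have Il : left_ideal I1 by apply: shift_ideal_left.
pose nilp t := exists N, I1 (s (E k c) ^+ N * t).
have nilpD t u : nilp t -> nilp u -> nilp (t + u).
  move=> [i It] [j Iu]; exists (i + j)%N; rewrite mulrDr.
  apply: (left_idealD Il); last by rewrite exprD -mulrA; apply: (left_idealM Il).
  by rewrite addnC exprD -mulrA; apply: (left_idealM Il).
suff H : forall t, nilp t -> nilp (x * t).
  have := H 1; rewrite mulr1; apply; exists 1%N; rewrite expr1 mulr1.
  exact: shift_ideal_gen.
elim/uea_inP: x => [d|x y IHx IHy|x y IHy] t nt.
- have [i It] := nt; exists i; rewrite mulrA -algc_central -mulrA.
  exact: (left_idealM Il).
- by rewrite mulrDl; apply: nilpD; [exact: IHx|exact: IHy].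
have [i It] := IHy t nt; exists (i + 3)%N; rewrite -mulrA.
apply: ad_nilpotent_mul => //=.
by rewrite !shift_commutator_in ad3_slE // uea_in0.
Qed.

Lemma shift_sum_slE x : s x = \sum_i \sum_j algc (vsval x i j) * s (E i j).
Proof.
have kD y z : killing e1 (y + z) = killing e1 y + killing e1 z.
  by rewrite !killingE // vsvalD mulmxDr mxtraceD mulrDr.
have kZ c y : killing e1 (c *: y) = c * killing e1 y.
  by rewrite !killingE // vsvalZ -scalemxAr mxtraceZ mulrCA.
have sD y z : s (y + z) = s y + s z.
  by rewrite /shift uea_inD kD rmorphD opprD addrACA.
have sZ c y : s (c *: y) = algc c * s y.
  by rewrite /shift uea_inZ kZ rmorphM mulrBr.
have s0 : s 0 = 0 by rewrite -(scale0r 0) sZ rmorph0 mul0r.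
rewrite {1}[x]slE_sum // (big_morph s sD s0); apply: eq_bigr => i _.
by rewrite (big_morph s sD s0); apply: eq_bigr => j _; apply: sZ.
Qed.

Lemma slE_pyr_m1 (k c : 'I_n) : (c < m)%N -> (c < k)%N -> E k c \in pyr_m1 K n mu.
Proof.
move=> cm ck; apply/mem_pyr_m1 => i j; rewrite val_slE //; last by rewrite -val_eqE /=; lia.
rewrite mxE; case: (eqVneq i k) => [->|_]; case: (eqVneq j c) => [->|_] /=;
  rewrite ?eqxx //; lia.
Qed.

(** m_1 consists of the full columns 0, ..., m - 1 below the diagonal, and the
    character is nonzero on the top unit E_(c+1,c) of each: hence the slices. *)
Lemma subregular_lift (J : uea (sl K n) -> Prop) : left_ideal J ->
  forall u, (forall x, x \in pyr_m1 K n mu -> J (s x * u)) ->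
  exists2 v, J (u - v) & invariant (pyr_m1 K n mu) (@uea_in K (sl K n)) (killing e1) v.
Proof.
move=> Jl u uJ; have Il : left_ideal I1 by apply: shift_ideal_left.
have gen_m1 N : (N < m * n)%N -> act N -> E (rowN N) (colN N) \in pyr_m1 K n mu.
  by move=> NM; rewrite act_lt //; apply: slE_pyr_m1; have [] := colNE NM.
have nilp N : (N < m * n)%N -> act N -> forall x, exists i, I1 (a N ^+ i * x).
  move=> NM aN; apply: slE_locally_nilpotent; last exact: gen_m1.
  by rewrite -act_lt.
have [|v Juv vI] := invariant_lift columns_commute column_slices Il Jl nilp (u := u).
  by move=> N NM aN; apply/uJ/gen_m1.
exists v => //; apply/invariantP => x /mem_pyr_m1 xm.
rewrite shift_sum_slE mulr_suml; apply: (big_ind I1) => [||i _].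
- exact: left_ideal0.
- exact: left_idealD.
rewrite mulr_suml; apply: (big_ind I1) => [||j _].
- exact: left_ideal0.
- exact: left_idealD.
rewrite -mulrA; have [->|/xm ij] := eqVneq (vsval x i j) 0.
  by rewrite rmorph0 mul0r; apply: left_ideal0.
apply: (left_idealM Il).
have jm : (j < m)%N by lia.
have ltN' : (j * n + i < m * n)%N.
  have: (j.+1 * n <= m * n)%N by rewrite leq_mul2r jm orbT.
  by rewrite mulSn; have := ltn_ord i; lia.
have := vI _ ltN'; rewrite aE act_lt // !indexE; apply; lia.
Qed.

Local Notation f := (pyr_E K n mu 1 2 1).

(** f normalises m_1 and commutes with e_1. *)
Lemma subregular_f_invariant :
  invariant (pyr_m1 K n mu) (@uea_in K (sl K n)) (killing e1) (uea_in f).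
Proof.
move=> x /mem_pyr_m1 xm; rewrite -uea_in_bracket.
have valxf k l : vsval (bracket x f) k l = - ((k == m.+1 :> nat)%:R * vsval x (inord m) l).
  rewrite val_bracket !mxE [X in X - _]big1 ?sub0r => [|j _]; last first.
    rewrite val_f; case: eqP => [jm|]; last by rewrite mulr0.
    have [->|/xm] := eqVneq (vsval x k j) 0; first by rewrite mul0r.
    by have := ltn_ord k; lia.
  rewrite (bigD1 (inord m)) //= big1 ?addr0 => [|j jm].
    by rewrite val_f inordK ?eqxx ?andbT // ltnW.
  rewrite val_f; case: (j =P m :> nat) => [E|]; last by rewrite andbF mul0r.
  by case/eqP: jm; apply: val_inj; rewrite /= inordK // ltnW.
have xfm : bracket x f \in pyr_m1 K n mu.
  apply/mem_pyr_m1 => k l; rewrite valxf.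
  case: (k =P m.+1 :> nat) => [km|_]; last by rewrite mul0r oppr0 eqxx.
  rewrite mul1r.
  rewrite oppr_eq0 => /xm.
  rewrite inordK; last exact: ltnW.
  rewrite km; lia.
have <- : s (bracket x f) = uea_in (bracket x f).
  rewrite /shift killing_eq0 ?rmorph0 ?subr0 // => k l.
  rewrite val_e1 valxf; case: (l =P m.+1 :> nat) => [->|_]; last by rewrite mul0r oppr0 mulr0.
  by have -> : (m.+1 == k.+1 :> nat) && (k < m)%N = false; [lia|rewrite mul0r].
exact: shift_ideal_gen.
Qed.

Theorem subregular_stages :
  exists phi : {rmorphism U_e1_k K n mu 1 2 -> U_m2 K n mu 1 2},
    alg_iso phi /\ induced_by_id phi.
Proof.
have kD (e y z : sl K n) : killing e (y + z) = killing e y + killing e z.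
  by rewrite !killingE // vsvalD mulmxDr mxtraceD mulrDr.
have kZ (e : sl K n) c y : killing e (c *: y) = c * killing e y.
  by rewrite !killingE // vsvalZ -scalemxAr mxtraceZ mulrCA.
rewrite /induced_by_id /U_e1_k /U_m2 /u_qhr /class_e1_k /class_m2 /comoment /kappa.
rewrite /pyr_m2 pyr_kE.
exact: (reduction_by_stages (@uea_inD K _) (@uea_inZ K _) (kD _) (kZ _)
  (@killing_e1_e2 K m) subregular_f_invariant subregular_lift).
Qed.

End SubregularSlices.

(** * The grading of a pyramid *)

Section DirectSeq.
Variables (K : fieldType) (V : vectType K) (I : eqType) (r : seq I).
Variable (U : I -> {vspace V}).
Hypothesis r_uniq : uniq r.

(** The list is traded for its positions, which form a finite index type. *)
Lemma directv_seqP :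
  reflect (forall u : I -> V, (forall i, i \in r -> u i \in U i) ->
             \sum_(i <- r) u i = 0 -> forall i, i \in r -> u i = 0)
    (directv (\sum_(i <- r) U i)).
Proof.
have -> : directv (\sum_(i <- r) U i)
    = directv (\sum_(i < size r) U (tnth (in_tuple r) i)).
  by rewrite !directvE /= !(big_tnth _ _ r).
have sumE (u : I -> V) : \sum_(i <- r) u i = \sum_(i < size r) u (tnth (in_tuple r) i).
  exact: big_tnth.
apply: (iffP directv_sum_independent) => [H u uU|H us usU].
  rewrite sumE => /(H (fun i => u (tnth (in_tuple r) i))) H0 i ir.
  have lt : (index i r < size r)%N by rewrite index_mem.
  have := H0 _ (Ordinal lt) isT; rewrite (tnth_nth i) /= nth_index //; apply.
  by move=> j _; apply/uU/mem_tnth.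
pose u i := oapp us 0 (insub (index i r)).
have uE i : u (tnth (in_tuple r) i) = us i.
  rewrite /u (tnth_nth (tnth (in_tuple r) i)) index_uniq // insubT //= => lt.
  by congr us; apply: val_inj.
move=> us0 i _; rewrite -uE; apply: H; last exact: mem_tnth.
  move=> j /(nthP j)[k kr <-]; have := usU (Ordinal kr) isT.
  by rewrite -uE (tnth_nth j).
by rewrite sumE -[RHS]us0; apply: eq_bigr => j _; apply: uE.
Qed.
End DirectSeq.

Section PyramidGrading.
Variables (K : numFieldType) (n : nat) (mu : seq nat).
Hypothesis n0 : (0 < n)%N.
Local Notation pieces := (pyr_piece K n mu).

Lemma pyr_deg_in (k l : 'I_n) : pyr_deg mu k l \in pyr_degrees n mu.
Proof. by rewrite mem_undup; apply/mapP; exists (k, l); rewrite ?mem_enum. Qed.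

Lemma pyr_piece0 d : d \notin pyr_degrees n mu -> pieces d = 0%VS.
Proof.
move=> nd; apply/eqP; rewrite -subv0; apply/subvP => x /mem_pyr_piece xd.
rewrite memv0; apply/eqP/sl_eq0 => k l; apply/eqP/contraT => /xd /eqP E.
by rewrite -E pyr_deg_in in nd.
Qed.

(** The pieces are abstracted by U so that directness is understood with indivisible
    summands, as in the type of gradings: a preimage of a subspace is itself a sum
    of two subspaces. *)
Lemma pyr_piece_direct :
  (fun U : int -> {vspace sl K n} => directv (\sum_(d <- pyr_degrees n mu) U d)) pieces.
Proof.
apply: (introT (directv_seqP pieces (undup_uniq _))) => u uP u0 d dd.
apply: sl_eq0 => k l; have [kl|kl] := eqVneq (pyr_deg mu k l) d; last first.
  by apply/eqP/contraT => /((mem_pyr_piece _ _ _).1 (uP d dd)) /eqP; move/eqP: kl.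
have := vsval_sum (pyr_degrees n mu) u k l.
rewrite u0 vsval0 mxE (bigD1_seq d) ?undup_uniq //= big_seq_cond big1 ?addr0 //.
move=> c /andP[cd nc]; apply/eqP/contraT => /((mem_pyr_piece _ _ _).1 (uP c cd)).
by rewrite kl eq_sym (negbTE nc).
Qed.

Lemma slE_pyr_piece (k l : 'I_n) : slE K k l \in pieces (pyr_deg mu k l).
Proof.
apply/mem_pyr_piece => i j; have [<-|kl] := eqVneq k l.
  have [<-|ij] := eqVneq i j; first by rewrite /pyr_deg !subrr.
  rewrite val_slp // !mxE (negbTE ij) mulr0n subr0.
  by case: (eqVneq i k) => [ik|_]; case: (eqVneq j k) => [jk|_]; rewrite ?eqxx //;
    rewrite ik jk eqxx in ij.
rewrite val_slE // mxE.
by case: (eqVneq i k) => [->|_]; case: (eqVneq j l) => [->|_]; rewrite ?eqxx.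
Qed.

Lemma pyr_piece_sum : (\sum_(d <- pyr_degrees n mu) pieces d)%VS = fullv.
Proof.
apply/eqP; rewrite eqEsubv subvf; apply/subvP => x _.
rewrite [x]slE_sum //; apply: memv_suml => k _; apply: memv_suml => l _.
apply/memvZ; rewrite (big_rem _ (pyr_deg_in k l)) /=.
exact/(subvP (addvSl _ _))/slE_pyr_piece.
Qed.

Lemma pyr_piece_bracket c d x y :
  x \in pieces c -> y \in pieces d -> bracket x y \in pieces (c + d).
Proof.
have mulP a b u v k l : u \in pieces a -> v \in pieces b ->
    (vsval u *m vsval v) k l != 0 -> pyr_deg mu k l == a + b.
  move=> /mem_pyr_piece ua /mem_pyr_piece vb; apply: contraR => kl.
  rewrite mxE big1 // => j _; apply/eqP; apply: contraR kl.
  rewrite mulf_eq0 negb_or => /andP[/ua /eqP <- /vb /eqP <-].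
  by rewrite /pyr_deg; apply/eqP; ring.
move=> xc yd; apply/mem_pyr_piece => k l; rewrite val_bracket.
have E (A B : 'M[K]_n) : (A - B) k l = A k l - B k l by rewrite !mxE.
rewrite E; have [xy0|/(mulP _ _ _ _ _ _ xc yd)//] := eqVneq ((vsval x *m vsval y) k l) 0.
by rewrite xy0 sub0r oppr_eq0 => /(mulP _ _ _ _ _ _ yd xc); rewrite addrC.
Qed.

Definition pyramid_grading : grading (sl K n) :=
  Grading (undup_uniq _) pyr_piece0 pyr_piece_direct pyr_piece_sum pyr_piece_bracket.

End PyramidGrading.

(** * The principal grading is good *)

Section RegularNilpotent.
Variables (K : numFieldType) (m : nat).
Local Notation n := m.+1.
Variable e : sl K n.
Hypothesis eE : forall k l : 'I_n, vsval e k l = (l == k.+1 :> nat)%:R.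
Local Notation J := (vsval e).

Lemma mul_jordan (A : 'M[K]_n) (k l : 'I_n) :
  (J *m A) k l = if (k.+1 < n)%N then A (inord k.+1) l else 0.
Proof.
rewrite mxE; case: ltnP => kn; last first.
  rewrite big1 // => j _; rewrite eE; have := ltn_ord j.
  by case: eqP => [|_]; rewrite ?mul0r //; lia.
rewrite (bigD1 (inord k.+1)) //= eE inordK // eqxx mul1r big1 ?addr0 // => j jk.
rewrite eE; case: eqP => [jE|]; last by rewrite mul0r.
by case/eqP: jk; apply: val_inj; rewrite /= inordK.
Qed.

Lemma jordan_mul (A : 'M[K]_n) (k l : 'I_n) :
  (A *m J) k l = if (0 < l)%N then A k (inord l.-1) else 0.
Proof.
rewrite mxE; case: posnP => l0.
  by rewrite big1 // => j _; rewrite eE l0 mulr0.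
have ln : (l.-1 < n)%N by have := ltn_ord l; lia.
rewrite (bigD1 (inord l.-1)) //= eE inordK // prednK // eqxx mulr1 big1 ?addr0 // => j jk.
rewrite eE; case: eqP => [jE|]; last by rewrite mulr0.
by case/eqP: jk; apply: val_inj; rewrite /= inordK // jE.
Qed.

(** Comparing entries, J A = A J says that A is constant along diagonals and vanishes
    below the main one. *)
Lemma jordan_centralizer (A : 'M[K]_n) : J *m A = A *m J ->
  forall k l, A k l = if (l < k)%N then 0 else A 0 (inord (l - k)).
Proof.
move=> JA k; have [p] := ubnP k; elim: p k => // p IHp [[|k] kn] //= kp l.
  by rewrite subn0 inord_val; congr (A _ _); apply: val_inj.
have kn' : (k < n)%N by apply: ltnW.
have := congr1 (fun B : 'M_n => B (Ordinal kn') l) JA; rewrite mul_jordan jordan_mul /= kn.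
have -> : inord k.+1 = Ordinal kn by apply: val_inj; rewrite /= inordK.
move=> ->; case: posnP => [-> //|l0].
rewrite IHp //= inordK; last by have := ltn_ord l; lia.
by rewrite -(ltn_predK l0) /= ltnS; case: ifP => // _; rewrite subSS.
Qed.

Lemma col_of_single (k : 'I_n) : col_of [:: n] k = (k * 2)%N.
Proof.
have single_row_boxes w : boxes [:: w] = [seq (1, c)%N | c <- iota 0 w].
  rewrite /boxes /= subnn; elim: (iota 0 w) => //= c s ->.
  by [].
by rewrite /col_of single_row_boxes (nth_map 0%N) ?size_iota // nth_iota.
Qed.

Local Notation pieces := (pyr_piece K n [:: n]).

Lemma regular_pieceP d (x : sl K n) :
  x \in pieces d <-> forall k l, vsval x k l != 0 -> (l * 2)%:Z - (k * 2)%:Z = d.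
Proof.
split=> [/mem_pyr_piece xd k l /xd /eqP <-|xd].
  by rewrite /pyr_deg !col_of_single.
by apply/mem_pyr_piece => k l /xd <-; rewrite /pyr_deg !col_of_single.
Qed.

Lemma regular_ad_injective d x : d <= -1 -> x \in pieces d -> bracket e x = 0 -> x = 0.
Proof.
move=> d1 /regular_pieceP xd ex.
have Jx : J *m vsval x = vsval x *m J.
  by apply/eqP; rewrite -subr_eq0 -val_bracket ex vsval0.
apply: sl_eq0 => k l; apply/eqP/contraT => xkl.
have := xd k l xkl; move: xkl; rewrite (jordan_centralizer Jx).
case: ltnP => [_|kl]; first by rewrite eqxx.
lia.
Qed.

(** y lives on one diagonal, l = k + r + 1, and [e, x] = y becomes the difference
    equation x_(k+1,l) - x_(k,l-1) = y_(k,l) on the diagonal l = k + r, which is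
    solved by partial sums. *)
Lemma regular_ad_surjective d y : -1 <= d -> y \in pieces (d + 2) ->
  exists2 x, x \in pieces d & bracket e x = y.
Proof.
move=> d1 yd; case: (boolP [exists k : 'I_n, exists l, vsval y k l != 0]); last first.
  move=> y0; exists 0; first exact: mem0v.
  rewrite bracket0r; apply/esym/sl_eq0 => k l; apply/eqP/contraT => ykl.
  by case/negP: y0; apply/existsP; exists k; apply/existsP; exists l.
move=> /existsP[k0 /existsP[l0 y0]].
have E0 := iffLR (regular_pieceP _ _) yd _ _ y0.
pose r := (l0 - k0.+1)%N.
have dr : d = (r * 2)%:Z by rewrite /r; lia.
(* The entries of y along its diagonal, extended by zero. *)
pose w i : K := if (i + r.+1 < n)%N then vsval y (inord i) (inord (i + r.+1)) else 0.
have yE k l : vsval y k l = if (l == k + r.+1 :> nat)%N then w k else 0.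
  case: eqP => [lk|lk]; first by rewrite /w -lk ltn_ord !inord_val.
  apply/eqP/contraT => /(iffLR (regular_pieceP _ _) yd k l); lia.
pose X : 'M[K]_n := \matrix_(k, l) (if (l == k + r :> nat)%N then \sum_(i < k) w i else 0).
have XE k l : X k l = if (l == k + r :> nat)%N then \sum_(i < k) w i else 0 by rewrite mxE.
exists (slp X); last first.
  have -> : bracket e (slp X) = slp (J *m X - X *m J) by rewrite -bracket_slp // slpK.
  apply: sl_valP; apply/matrixP => k l.
  rewrite val_slp0 ?tr_commutator // yE [LHS]mxE [X in _ + X]mxE mul_jordan jordan_mul.
  case: eqP => lk.
    have kn : (k.+1 < n)%N by have := ltn_ord l; lia.
    have l1 : (0 < l)%N by rewrite lk; lia.
    rewrite kn l1 !XE !inordK //; last by have := ltn_ord l; lia.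
    have -> : (l == k.+1 + r :> nat)%N by rewrite lk; lia.
    have -> : (l.-1 == k + r :> nat)%N by rewrite lk; lia.
    by rewrite big_ord_recr /= addrAC subrr add0r.
  rewrite (_ : (if _ then _ else _) = 0) ?sub0r; last first.
    by case: ifP => // kn; rewrite XE inordK //; case: eqP => // lk'; lia.
  rewrite (_ : (if _ then _ else _) = 0) ?oppr0 //.
  case: ifP => // l1; rewrite XE inordK //; last by have := ltn_ord l; lia.
  case: eqP => // lk'; lia.
(* Projecting X to sl_n only subtracts a nonzero scalar when r = 0, and scalars
   have degree 0. *)
apply/regular_pieceP => k l; rewrite val_slp // [X in X != 0]mxE XE [X in _ + X]mxE.
rewrite [X in _ + - X]mxE; case: (l =P (k + r)%N :> nat) => [lk _|lk]; first by rewrite dr; lia.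
case: (k =P l) => [kl|_]; last by rewrite mulr0n subr0 eqxx.
have r0 : (r != 0)%N by apply/eqP => r0; apply: lk; rewrite r0 kl addn0.
have -> : \tr X = 0.
  by rewrite /mxtrace big1 // => i _; rewrite XE; case: eqP => //; lia.
by rewrite mul0r mul0rn subr0 eqxx.
Qed.

Lemma regular_piece2 : e \in pieces 2.
Proof.
apply/regular_pieceP => k l; rewrite eE.
case: (l =P k.+1 :> nat) => [->|_]; rewrite ?eqxx //; lia.
Qed.

Lemma regular_piece_odd : pieces (-1) = 0%VS.
Proof.
apply/eqP; rewrite -subv0; apply/subvP => x /regular_pieceP xd.
by rewrite memv0; apply/eqP/sl_eq0 => k l; apply/eqP/contraT => /xd; lia.
Qed.

(** The grading is even, so the zero space is Lagrangian. *)
Lemma regular_good_grading : exists (G : grading (sl K n)) (l : {vspace sl K n}),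
  good_grading G e /\ lagrangian G e l.
Proof.
exists (pyramid_grading K [:: n] (ltn0Sn m)), 0%VS; split.
  split; [exact: regular_piece2|exact: regular_ad_injective|exact: regular_ad_surjective].
move=> x; rewrite /= regular_piece_odd memv0; split=> [/eqP->|[]//].
split=> // y _; rewrite /omega; apply: killing_eq0 => // k l.
by rewrite bracketC bracket0r oppr0 vsval0 mxE mulr0.
Qed.

End RegularNilpotent.

(** * Automorphisms and gradings of a Lie algebra *)

Section LieIso.
Variables (K : fieldType) (g : lieAlgType K) (e : g).

(** One direction of the isomorphism of reductions; it is applied to sigma and to its
    inverse. *)
Section Transport.
Variables (sigma tau : g -> g) (m m' : {vspace g}) (F : {rmorphism uea g -> uea g}).
Hypotheses (tauK : cancel tau sigma) (sm : forall x, x \in m -> sigma x \in m')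
  (tm : forall x, x \in m' -> tau x \in m)
  (se : forall x, killing e (sigma x) = killing e x).
Hypotheses (Fc : forall c, F (algc c) = algc c)
  (Fi : forall x, F (uea_in x) = uea_in (sigma x)).

Local Notation I := (shift_ideal m (@uea_in K g) (killing e)).
Local Notation I' := (shift_ideal m' (@uea_in K g) (killing e)).
Local Notation s := (shift (@uea_in K g) (killing e)).

Lemma uea_map_shift x : F (s x) = s (sigma x).
Proof. by rewrite /shift rmorphB Fc Fi se. Qed.

Lemma uea_map_ideal u : I u -> I' (F u).
Proof.
apply: (shift_ideal_min (D := fun u => I' (F u))) => [|y ym].
  split=> [|u1 u2|a u1].
  - by rewrite rmorph0; apply: shift_ideal0.
  - by rewrite rmorphD; apply: shift_idealD.
  - by rewrite rmorphM; apply: shift_idealMl.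
by rewrite uea_map_shift; apply/shift_ideal_gen/sm.
Qed.

Lemma uea_map_invariant u : invariant m (@uea_in K g) (killing e) u ->
  invariant m' (@uea_in K g) (killing e) (F u).
Proof.
move=> /invariantP iu; apply/invariantP => y ym.
by rewrite -[y]tauK -uea_map_shift -rmorphM; apply/uea_map_ideal/iu/tm.
Qed.
End Transport.

(** A reduction depends only on the orbit of the pair (m, e) under automorphisms of g
    that preserve the linear form killing e. *)
Lemma u_qhr_isomorphic (sigma tau : g -> g) (m m' : {vspace g}) :
  linear sigma -> linear tau ->
  (forall x y, sigma (bracket x y) = bracket (sigma x) (sigma y)) ->
  cancel sigma tau -> cancel tau sigma ->
  (forall x, (x \in m) = (sigma x \in m')) ->
  (forall x, killing e (sigma x) = killing e x) ->
  alg_isomorphic (u_qhr m e) (u_qhr m' e).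
Proof.
move=> sl tl sb sK tK smE se.
have tb x y : tau (bracket x y) = bracket (tau x) (tau y).
  by apply: (can_inj sK); rewrite sb !tK.
have te x : killing e (tau x) = killing e x by rewrite -se tK.
have sm x : x \in m -> sigma x \in m' by rewrite smE.
have tm x : x \in m' -> tau x \in m by rewrite smE tK.
have [F [Fc Fi]] := uea_map_exists sl sb.
have [F' [Fc' Fi']] := uea_map_exists tl tb.
have FK : cancel F F'.
  elim/uea_inP => [c|u v IHu IHv|x u IHu]; first by rewrite Fc Fc'.
    by rewrite !rmorphD /= IHu IHv.
  by rewrite !rmorphM /= IHu Fi Fi' sK.
have FK' : cancel F' F.
  elim/uea_inP => [c|u v IHu IHv|x u IHu]; first by rewrite Fc' Fc.
    by rewrite !rmorphD /= IHu IHv.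
  by rewrite !rmorphM /= IHu Fi' Fi tK.
have Finv := uea_map_invariant tK sm tm se Fc Fi.
have Finv' := uea_map_invariant sK tm sm te Fc' Fi'.
have Fid := uea_map_ideal sm se Fc Fi.
have Fid' := uea_map_ideal tm te Fc' Fi'.
pose cl := @qhr_class K _ _ m (@uea_in K g) (killing e).
pose cl' := @qhr_class K _ _ m' (@uea_in K g) (killing e).
pose inv := invariant m (@uea_in K g) (killing e).
pose R q w := exists u, [/\ inv u, q = cl u & w = cl' (F u)].
have [|||||||phi [phi_iso _]] := @alg_iso_of_rel K (u_qhr m e) (u_qhr m' e) R;
  last by exists phi.
- by move=> q; have [u iu ->] := qhr_class_surj q; exists (cl' (F u)), u.
- move=> w; have [u iu ->] := qhr_class_surj w.
  by exists (cl (F' u)), (F' u); rewrite FK'; split=> //; apply: Finv'.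
- move=> b [u [iu E ->]]; apply/qhr_class_eq0; first exact: Finv.
  by apply/Fid/(qhr_class_eq0 iu).
- move=> a [u [iu -> E]]; apply/qhr_class_eq0 => //.
  by rewrite -[u]FK; apply/Fid'/(qhr_class_eq0 (Finv _ iu)).
- move=> _ _ _ _ [u [iu -> ->]] [v [iv -> ->]]; exists (u - v).
  have E : F (u - v) = F u - F v := rmorphB F u v.
  split; [exact: (invariantB iu iv)|exact: (esym (qhr_classB iu iv))|].
  by rewrite E; exact: (esym (qhr_classB (Finv _ iu) (Finv _ iv))).
- move=> _ _ _ _ [u [iu -> ->]] [v [iv -> ->]]; exists (u * v).
  have E : F (u * v) = F u * F v := rmorphM F u v.
  split; [exact: (invariantM iu iv)|exact: (esym (qhr_classM iu iv))|].
  by rewrite E; exact: (esym (qhr_classM (Finv _ iu) (Finv _ iv))).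
- move=> c; exists (algc c); rewrite Fc /cl /cl' !qhr_class_algc.
  by split=> //; exact: invariant_algc.
Qed.
End LieIso.

Section GradingTheory.
Variables (K : fieldType) (g : lieAlgType K) (G : grading g).

Lemma grading_decomposition (x : g) : exists2 u : int -> g,
  forall d, u d \in piece G d & x = \sum_(d <- degrees G) u d.
Proof.
pose defV := esym (piece_sum G).
exists (fun d => sumv_pi_for defV d x) => [d|]; first exact: memv_sum_pi.
rewrite sumv_pi_uniq_sum ?memvf //.
by rewrite filter_predT degrees_uniq.
Qed.

Lemma grading_ind (P : g -> Prop) : P 0 -> (forall x y, P x -> P y -> P (x + y)) ->
  (forall d x, x \in piece G d -> P x) -> forall x, P x.
Proof.
move=> P0 PD Pp x; have [u up ->] := grading_decomposition x.
by apply: big_ind => // d _; apply: Pp (up d).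
Qed.

(** The operator D acting by d on degree d is a derivation because brackets add
    degrees. *)
Lemma degree_derivation : exists D : 'End(g),
  (forall d x, x \in piece G d -> D x = d%:~R *: x) /\
  (forall x y, D (bracket x y) = bracket (D x) y + bracket x (D y)).
Proof.
pose defV := esym (piece_sum G).
pose p d : 'End(g) := sumv_pi_for defV d.
pose D : 'End(g) := \sum_(d <- degrees G) d%:~R *: p d.
have Dp d x : x \in piece G d -> D x = d%:~R *: x.
  move=> xd; have [dG|dG] := boolP (d \in degrees G); last first.
    by move: xd; rewrite piece_degrees // memv0 => /eqP ->; rewrite linear0 scaler0.
  pose u c := p c x - (if c == d then x else 0).
  have u0 : \sum_(c <- degrees G) u c = 0.
    rewrite sumrB sumv_pi_uniq_sum ?memvf ?filter_predT ?degrees_uniq //.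
    rewrite (bigD1_seq d) ?degrees_uniq //= eqxx big1 ?addr0 ?subrr //.
    by move=> c /negPf ->.
  have up c : c \in degrees G -> u c \in piece G c.
    move=> _; apply: memvB; first exact: memv_sum_pi.
    by case: eqP => [->|_] //; apply: mem0v.
  have uE c : c \in degrees G -> p c x = if c == d then x else 0.
    move=> cG; apply/eqP; rewrite -subr_eq0; apply/eqP.
    by have /(_ u up u0 c cG) := elimT (directv_seqP _ (degrees_uniq G)) (piece_direct G).
  rewrite sum_lfunE (bigD1_seq d) ?degrees_uniq //= scale_lfunE uE // eqxx.
  rewrite big_seq_cond big1 ?addr0 // => c /andP[cG cd].
  by rewrite scale_lfunE uE // (negbTE cd) scaler0.
exists D; split=> //.
apply: grading_ind => [|x x' IHx IHx'|c x xc] y.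
- by rewrite linear0 !bracket0l linear0 addr0.
- by rewrite bracketDl !linearD /= bracketDl IHx IHx' bracketDl addrACA.
elim/grading_ind: y => [|y y' IHy IHy'|d y yd].
- by rewrite bracket0r !linear0 !bracket0r addr0.
- by rewrite bracketDr !linearD /= IHy IHy' !bracketDr addrACA.
rewrite (Dp _ _ xc) (Dp _ _ yd) (Dp _ _ (piece_bracket xc yd)).
by rewrite bracketZl bracketZr -scalerDl -intrD.
Qed.

End GradingTheory.

(** * Derivations of sl_n are inner *)

Section AdTheory.
Variables (K : fieldType) (g : lieAlgType K).
Implicit Types x y : g.

(** ad (E x) = [E, ad x], so by cyclicity of the trace the pairing of E x with y is
    the trace of E ad [x, y]. *)
Lemma derivation_orthogonal (E : 'End(g)) :
  (forall x y, E (bracket x y) = bracket (E x) y + bracket x (E y)) ->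
  (forall x, end_trace (E \o ad x)%VF = 0) -> forall x y, killing (E x) y = 0.
Proof.
move=> Eder E0 x y; rewrite /killing -[lfun_trace _]/(end_trace _).
have -> : ad (E x) = ((E \o ad x) - (ad x \o E))%VF.
  apply/lfunP => z; rewrite [RHS]add_lfunE opp_lfunE !comp_lfunE !adE Eder.
  by rewrite addrK.
rewrite comp_lfunDl comp_lfunNl end_traceB -!comp_lfunA.
rewrite (end_traceC (E \o ad y)%VF) -comp_lfunA -(E0 (bracket x y)).
by rewrite ad_bracket comp_lfunDr comp_lfunNr end_traceB.
Qed.

End AdTheory.

Section SlInner.
Variables (K : numFieldType) (n : nat).
Hypothesis n0 : (0 < n)%N.

Lemma natr2n_neq0 : (2 * n)%:R != 0 :> K.
Proof. by rewrite pnatr_eq0 muln_eq0 -lt0n n0. Qed.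

Lemma killing_nondegenerate (x : sl K n) : (forall y, killing x y = 0) -> x = 0.
Proof.
move=> x0; apply: sl_eq0 => k l; have /eqP := x0 (slE K l k).
by rewrite killing_slE // mulf_eq0 (negPf natr2n_neq0) => /eqP.
Qed.

Lemma killing_represents (phi : sl K n -> K) : linear (phi : sl K n -> K^o) ->
  exists h, forall x, killing h x = phi x.
Proof.
move=> phil; pose H : 'M[K]_n := \matrix_(i, j) (phi (slE K j i) / (2 * n)%:R).
have [F FE] := linfun_exists phil.
exists (slp H) => x; rewrite killingE // val_slp // mulmxBl mul_scalar_mx linearB /=.
rewrite mxtraceZ tr_val mulr0 subr0 mxtrace_mul.
rewrite -FE {2}[x]slE_sum // linear_sum exchange_big mulr_sumr; apply: eq_bigr => i _ /=.
rewrite linear_sum mulr_sumr; apply: eq_bigr => j _ /=.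
rewrite linearZ /= FE mxE mulrC mulrAC divfK ?natr2n_neq0 //.
by rewrite mulrC.
Qed.

(** The linear form x |-> tr(D ad x) is represented by some h for the Killing form;
    D - ad h is then a derivation orthogonal to all ad x, hence zero. *)
Lemma sl_derivation_inner (D : 'End(sl K n)) :
  (forall x y, D (bracket x y) = bracket (D x) y + bracket x (D y)) ->
  exists h, forall x, D x = bracket h x.
Proof.
move=> Dder; have [|h hE] := @killing_represents (fun x => end_trace (D \o ad x)%VF).
  by move=> c x y; rewrite ad_linear comp_lfunDr -comp_lfunZr end_trace_linear.
pose E := D - ad h.
have EE x : E x = D x - bracket h x by rewrite [LHS]add_lfunE opp_lfunE adE.
have Eder x y : E (bracket x y) = bracket (E x) y + bracket x (E y).
  have := congr1 (fun f : 'End(sl K n) => f y) (ad_bracket h x).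
  rewrite [RHS]add_lfunE opp_lfunE !comp_lfunE !adE => adh.
  rewrite !EE Dder bracketDl bracketDr bracketNl bracketNr adh.
  by rewrite opprB addrACA; congr (_ + _); rewrite addrAC subrr sub0r.
exists h => x; apply/eqP; rewrite -subr_eq0 -EE; apply/eqP/killing_nondegenerate => y.
apply: derivation_orthogonal => // u.
rewrite comp_lfunDl comp_lfunNl end_traceB -hE.
by rewrite /killing -[lfun_trace _]/(end_trace _) subrr.
Qed.

Lemma grading_element (G : grading (sl K n)) :
  exists h, forall d x, x \in piece G d -> bracket h x = d%:~R *: x.
Proof.
have [D [Dp Dder]] := degree_derivation G; have [h hE] := sl_derivation_inner Dder.
by exists h => d x xd; rewrite -hE (Dp d).
Qed.

End SlInner.

(** * Conjugating a good grading to the principal one *)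

Section Conjugation.
Variables (K : numFieldType) (m : nat).
Local Notation n := m.+1.
Variable e : sl K n.
Hypothesis eE : forall k l : 'I_n, vsval e k l = (l == k.+1 :> nat)%:R.
Local Notation J := (vsval e).

Variable h : sl K n.
Hypothesis he : bracket h e = 2 *: e.
Local Notation H := (vsval h).

(** The diagonal entries of the principal grading element h_0. *)
Let wt (k : 'I_n) : K := m%:R - (k * 2)%:R.

Lemma neutral_jordan : H *m J = J *m H + 2 *: J.
Proof. by apply/eqP; rewrite addrC -subr_eq -vsvalZ -he val_bracket. Qed.

Let Z : 'M[K]_n := H - \matrix_(k, l) (wt k *+ (k == l)).

Let ZE k l : Z k l = H k l - wt k *+ (k == l).
Proof. by rewrite !mxE. Qed.

Lemma weights_jordan (W := \matrix_(k, l) (wt k *+ (k == l)) : 'M[K]_n) :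
  W *m J = J *m W + 2 *: J.
Proof.
apply/matrixP => k l.
have ED (A B : 'M[K]_n) c : (A + c *: B) k l = A k l + c * B k l by rewrite !mxE.
rewrite ED (jordan_mul eE) (mul_jordan eE).
have ln := ltn_ord l; have kn := ltn_ord k.
have [lk|lk] := eqVneq (l : nat) k.+1.
  have k1 : (k.+1 < n)%N by lia.
  have -> : inord l.-1 = k by apply: val_inj; rewrite /= inordK lk //= ltnW.
  have -> : inord k.+1 = l by apply: val_inj; rewrite /= inordK.
  rewrite k1 lk /= !mxE !eqxx eE lk eqxx mulr1 !mulr1n /wt lk mulSn natrD; ring.
rewrite eE (negbTE lk) mulr0 addr0.
transitivity (0 : K).
  case: posnP => // l0; rewrite mxE (_ : (k == _) = false) //; apply/eqP => E.
  by move/eqP: lk; apply; rewrite E inordK; lia.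
case: ltnP => // k1; rewrite mxE (_ : (_ == l) = false) //; apply/eqP => E.
by move/eqP: lk; apply; rewrite -E inordK.
Qed.

(** h and h_0 act alike on e, so h - h_0 centralises the Jordan block. *)
Lemma neutral_toeplitz : forall k l, Z k l = if (l < k)%N then 0 else Z 0 (inord (l - k)).
Proof.
apply: (jordan_centralizer eE); rewrite mulmxBr mulmxBl neutral_jordan weights_jordan.
by rewrite opprD addrACA subrr addr0.
Qed.

Lemma tr_weights : \sum_k wt k = 0.
Proof.
have E p : \sum_(k < p) (m%:R - (k * 2)%:R) = p%:R * (m%:R - p%:R + 1) :> K.
  elim: p => [|p IHp]; first by rewrite big_ord0 mul0r.
  rewrite big_ord_recr /= IHp natrM -(natr1 p); ring.
by rewrite E -(natr1 m); ring.
Qed.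

(** h - h_0 is traceless with constant diagonal. *)
Lemma neutral_toeplitz0 : Z 0 0 = 0.
Proof.
have D (k : 'I_n) : Z k k = Z 0 0.
  by rewrite neutral_toeplitz ltnn subnn; congr (Z _ _); apply: val_inj; rewrite /= inordK.
have : \sum_k Z k k = 0.
  under eq_bigr => k _ do rewrite ZE eqxx mulr1n.
  by rewrite sumrB tr_weights subr0; exact: (tr_val h).
under eq_bigr => k _ do rewrite D.
by rewrite sumr_const card_ord => /eqP; rewrite mulrn_eq0 /= => /eqP.
Qed.

Lemma neutral_lower (k l : 'I_n) :
  (l < k)%N -> H k l = 0.
Proof.
move=> lk; have := neutral_toeplitz k l; rewrite lk ZE (_ : (k == l) = false) ?mulr0n ?subr0 //.
by apply/eqP => kl; rewrite kl ltnn in lk.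
Qed.

Lemma neutral_diag (k : 'I_n) : H k k = wt k.
Proof.
have := neutral_toeplitz k k; rewrite ltnn subnn ZE eqxx mulr1n.
rewrite (_ : inord 0 = 0) ?neutral_toeplitz0; last by apply: val_inj; rewrite /= inordK.
by move/eqP; rewrite subr_eq0 => /eqP.
Qed.

(** The first column of H - m vanishes, so H has a row eigenvector for m.  Its first
    nonzero entry sits at a diagonal entry of H equal to m, and only the first one
    is. *)
Lemma weight_vector : exists w : 'rV[K]_n, w *m H = m%:R *: w /\ w 0 0 != 0.
Proof.
have [w w0 wH] : exists2 w : 'rV[K]_n, w != 0 & w *m (H - m%:R%:M) = 0.
  apply/det0P; rewrite -det_tr; apply/det0P.
  exists (delta_mx 0 0).
    apply/eqP => /matrixP/(_ 0 0); rewrite !mxE => /eqP; by rewrite oner_eq0.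
  apply/rowP => j; rewrite -rowE !mxE.
  case: (posnP j) => [j0|j0].
    have -> : j = 0 by apply: val_inj.
    by rewrite neutral_diag /wt mul0n subr0 eqxx subrr.
  have jn0 : (j == 0) = false by apply/negbTE; apply: contraTneq j0 => ->.
  by rewrite neutral_lower // jn0 mulr0n subrr.
have wH' : w *m H = m%:R *: w.
  by apply/eqP; rewrite -subr_eq0 -mul_mx_scalar -mulmxBr wH.
exists w; split=> //; apply: contraNneq w0 => w00; apply/eqP/rowP => j; rewrite mxE.
have [p] := ubnP j; elim: p j => // p IHp j jp.
case: (posnP j) => [j0|j0].
  by rewrite -w00; congr (w _ _); apply: val_inj.
have := congr1 (fun A : 'rV_n => A 0 j) wH'; rewrite [RHS]mxE mxE (bigD1 j) //=.
rewrite big1 ?addr0 => [|i ij].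
  move/eqP; rewrite neutral_diag mulrC -subr_eq0 -mulrBl mulf_eq0 /wt addrAC subrr sub0r.
  by rewrite oppr_eq0 pnatr_eq0 muln_eq0 => /orP[/orP[/eqP jz|//]|/eqP//]; rewrite jz in j0.
case: (ltngtP i j) => [lt|gt|/val_inj E]; last by rewrite E eqxx in ij.
  by rewrite IHp ?mul0r //; lia.
by rewrite neutral_lower // mulr0.
Qed.

(** The rows of P are w J^k: each multiplication by J lowers the eigenvalue by 2, as
    h J = J h + 2 J. *)
Lemma neutral_conjugate : exists P : 'M[K]_n,
  [/\ P \in unitmx, P *m J = J *m P &
      forall k l, (P *m H) k l = wt k * P k l].
Proof.
have [w [wH w0]] := weight_vector.
pose P : 'M[K]_n := \matrix_(k, l) (if (l < k)%N then 0 else w 0 (inord (l - k))).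
have PE k l : P k l = if (l < k)%N then 0 else w 0 (inord (l - k)) by rewrite mxE.
have PJ : P *m J = J *m P.
  apply/matrixP => k l; rewrite (mul_jordan eE) (jordan_mul eE).
  have ln := ltn_ord l; have kn := ltn_ord k.
  case: (ltnP k.+1 n) => k1; case: (posnP l) => l0 //.
  - by rewrite PE inordK // l0.
  - rewrite !PE !inordK //; last by lia.
    rewrite (_ : (l.-1 < k)%N = (l < k.+1)%N); last by lia.
    by case: ifP => // _; congr (w _ (inord _)); lia.
  - by rewrite PE inordK; last lia; rewrite (_ : (l.-1 < k)%N = true) //; lia.
exists P; split=> //.
  rewrite unitmxE unitfE -det_tr det_trig.
    apply/prodf_neq0 => i _; rewrite mxE PE ltnn subnn.
    by rewrite (_ : inord 0 = 0) //; apply: val_inj; rewrite /= inordK.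
  by apply/is_trig_mxP => i j ij; rewrite mxE PE ij.
suff R k : forall kn : (k < n)%N, forall l,
    (P *m H) (Ordinal kn) l = wt (Ordinal kn) * P (Ordinal kn) l.
  by move=> [k kn] l; apply: R.
elim: k => [|k IHk] kn l.
  have := congr1 (fun A : 'rV_n => A 0 l) wH; rewrite [RHS]mxE [wt _]/wt mul0n subr0.
  rewrite PE /= subn0 inord_val => <-; rewrite !mxE; apply: eq_bigr => j _.
  by rewrite PE /= subn0 inord_val.
have kn' : (k < n)%N := ltnW kn.
have E : J *m (P *m H) = (P *m H) *m J - 2 *: (P *m J).
  rewrite mulmxA -PJ -!mulmxA neutral_jordan mulmxDr -scalemxAr addrK //.
have ko : inord (Ordinal kn').+1 = Ordinal kn by apply: val_inj; rewrite /= inordK.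
have := congr1 (fun A : 'M_n => A (Ordinal kn') l) E.
have EB (A B : 'M[K]_n) i j : (A - B) i j = A i j - B i j by rewrite !mxE.
have EZ c (A : 'M[K]_n) i j : (c *: A) i j = c * A i j by rewrite !mxE.
rewrite EB EZ (mul_jordan eE) /= kn ko => ->.
have -> : (P *m H *m J) (Ordinal kn') l = wt (Ordinal kn') * (P *m J) (Ordinal kn') l.
  by rewrite !(jordan_mul eE); case: ifP => _; rewrite ?mulr0 // IHk.
rewrite -mulrBl PJ (mul_jordan eE) /= kn ko; congr (_ * _).
by rewrite /wt /= mulSn natrD; ring.
Qed.

End Conjugation.

(** * The W-algebra of a regular nilpotent *)

Section RegularWAlgebra.
Variables (K : numFieldType) (m : nat).
Local Notation n := m.+1.
Variable e : sl K n.
Hypothesis eE : forall k l : 'I_n, vsval e k l = (l == k.+1 :> nat)%:R.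
Local Notation J := (vsval e).

Section Conj.
Variable P : 'M[K]_n.
Hypothesis Pu : P \in unitmx.

Definition conj_sl (x : sl K n) : sl K n := slp (P *m vsval x *m invmx P).

Lemma val_conj_sl x : vsval (conj_sl x) = P *m vsval x *m invmx P.
Proof. by rewrite val_slp0 // -mulmxA mxtrace_mulC -mulmxA mulVmx // mulmx1 tr_val. Qed.

Lemma conj_sl_linear : linear conj_sl.
Proof.
move=> c x y; apply: sl_valP; rewrite vsvalP !val_conj_sl vsvalP.
by rewrite mulmxDr mulmxDl -scalemxAr -scalemxAl.
Qed.

Lemma conj_sl0 : conj_sl 0 = 0.
Proof. by apply: sl_valP; rewrite val_conj_sl vsval0 mulmx0 mul0mx. Qed.

Lemma conj_sl_bracket x y : conj_sl (bracket x y) = bracket (conj_sl x) (conj_sl y).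
Proof.
have E (A B : 'M[K]_n) : P *m (A *m B) *m invmx P = P *m A *m invmx P *m (P *m B *m invmx P).
  by rewrite -!mulmxA (mulmxA (invmx P) P) mulVmx // mul1mx.
apply: sl_valP; rewrite val_conj_sl !val_bracket !val_conj_sl mulmxBr mulmxBl.
by rewrite !E.
Qed.

Lemma killing_conj_sl x : P *m J = J *m P -> killing e (conj_sl x) = killing e x.
Proof.
move=> PJ; rewrite !killingE // val_conj_sl !mulmxA -PJ mxtrace_mulC !mulmxA.
by rewrite mulVmx // mul1mx.
Qed.

End Conj.

Lemma conj_slK (P : 'M[K]_n) : P \in unitmx -> cancel (conj_sl P) (conj_sl (invmx P)).
Proof.
move=> Pu x; apply: sl_valP; rewrite !val_conj_sl ?unitmx_inv // invmxK.
by rewrite !mulmxA mulVmx // mul1mx -mulmxA mulVmx // mulmx1.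
Qed.

Variables (G : grading (sl K n)) (l : {vspace sl K n}).
Hypotheses (Gg : good_grading G e) (Gl : lagrangian G e l).

(** The element h defining the degree of G is conjugate to h_0 by a matrix that
    commutes with J. *)
Lemma regular_grading_conjugate : exists P : 'M[K]_n,
  [/\ P \in unitmx, P *m J = J *m P &
      forall d x, x \in piece G d -> conj_sl P x \in pyr_piece K n [:: n] d].
Proof.
have [h hG] := grading_element (ltn0Sn m) G.
have [e2 _ _] := Gg.
have [|P [Pu PJ PH]] := @neutral_conjugate K m e eE h; first exact: (hG 2).
exists P; split=> // d x /hG hx; apply/regular_pieceP => // k j.
set Y := vsval (conj_sl P x) => Ykj.
pose W : 'M[K]_n := diag_mx (\row_i (m%:R - (i * 2)%:R)).
have hW : vsval (conj_sl P h) = W.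
  have PHW : P *m vsval h = W *m P.
    by apply/matrixP => i i'; rewrite PH mul_diag_mx !mxE.
  by rewrite val_conj_sl // PHW mulmxK.
have := congr1 (fun z => vsval (conj_sl P z) k j) hx.
rewrite conj_sl_bracket // val_bracket hW -/Y.
have -> : conj_sl P (d%:~R *: x) = d%:~R *: conj_sl P x.
  by have [S SE] := linfun_exists (conj_sl_linear Pu); rewrite -!SE linearZ.
rewrite vsvalZ -/Y.
have ZE c (A : 'M[K]_n) : (c *: A) k j = c * A k j by rewrite !mxE.
have BE (A B : 'M[K]_n) : (A - B) k j = A k j - B k j by rewrite !mxE.
rewrite BE ZE mul_diag_mx mul_mx_diag !mxE (mulrC (Y k j)) -mulrBl => /(mulIf Ykj).
move=> E; apply: (@intr_inj K); rewrite rmorphB /= -E -!pmulrn; ring.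
Qed.

(** Since degrees of the conjugated grading are even, g_(-1) = 0 and the Lagrangian l
    is zero; conjugation then sends the Premet subalgebra, the sum of the pieces
    of negative degree, onto the strictly lower triangular matrices. *)
Theorem regular_W_algebra_iso (b : {vspace sl K n}) :
  (forall x, x \in b <-> forall k j, vsval x k j != 0 -> (j < k)%N) ->
  alg_isomorphic (W_algebra G l e) (u_qhr b e).
Proof.
move=> bP; have [P [Pu PJ PG]] := regular_grading_conjugate.
have Vu : invmx P \in unitmx by rewrite unitmx_inv.
have sK := conj_slK Pu; have tK : cancel (conj_sl (invmx P)) (conj_sl P).
  by have := conj_slK Vu; rewrite invmxK.
have l0 x : x \in l -> x = 0.
  move=> /Gl[/PG]; rewrite regular_piece_odd memv0 => /eqP x0 _.
  by rewrite -[x]sK x0 conj_sl0.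
apply: (@u_qhr_isomorphic _ _ e (conj_sl P) (conj_sl (invmx P))) => //.
- exact: conj_sl_linear.
- exact: conj_sl_linear.
- exact: conj_sl_bracket.
- have [S SE] := linfun_exists (conj_sl_linear Pu).
  move=> x; apply/idP/idP.
    move=> /memv_addP[y /l0 -> [z zm ->]]; rewrite add0r -SE memv_preim.
    apply: (subvP _ _ zm); apply: (big_ind (fun U => U <= S @^-1: b)%VS) => [|U V Ub Vb|d d2].
    + exact: sub0v.
    + by rewrite subv_add Ub.
    apply/subvP => y' /PG /regular_pieceP yd; rewrite -memv_preim SE.
    by apply/bP => k j /yd; lia.
  move=> /bP xb; have [u up xE] := grading_decomposition G x.
  apply: (subvP (addvSr _ _)); rewrite xE (bigID (fun d => (d <= -2)%R)) /=.
  rewrite [X in _ + X]big_seq_cond [X in _ + X]big1 ?addr0 => [|d /andP[dG d2]].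
    rewrite big_seq_cond; apply: memv_suml => d /andP[dG d2].
    by rewrite (big_rem d dG) /= d2; apply: (subvP (addvSl _ _)).
  rewrite -[u d]sK (_ : conj_sl P (u d) = 0) ?conj_sl0 //.
  apply: sl_eq0 => k j; apply/eqP/contraT => ukj.
  have ud c : vsval (conj_sl P (u c)) k j != 0 -> (j * 2)%:Z - (k * 2)%:Z = c.
    by have /regular_pieceP := PG c _ (up c); apply.
  have dE := ud d ukj.
  have : (j < k)%N; last by lia.
  apply: xb; rewrite xE -SE linear_sum vsval_sum (bigD1_seq d) ?degrees_uniq //=.
  rewrite big1 ?addr0 ?SE // => c cd; rewrite SE; apply/eqP/contraT => /ud cE.
  by rewrite -cE dE eqxx in cd.
by move=> x; apply: killing_conj_sl.
Qed.

End RegularWAlgebra.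

Unset Implicit Arguments.
Local Close Scope ring_scope.

Theorem proposition3p15 (R : realType) (n : nat) (hn : (2 <= n)%N) :
  let mu := [:: n.-1; 1%N] in
  let W1k := U_e1_k R[i] n mu 1 2 in
  let e2 := pyr_e2 R[i] n mu 1 2 in
  (exists phi : {rmorphism W1k -> U_m2 R[i] n mu 1 2},
      alg_iso phi /\ induced_by_id phi) /\
  (exists (G : grading (sl R[i] n)) (l : {vspace sl R[i] n}),
      good_grading G e2 /\ lagrangian G e2 l) /\
  (forall (G : grading (sl R[i] n)) (l : {vspace sl R[i] n}),
      good_grading G e2 -> lagrangian G e2 l ->
      alg_isomorphic W1k (W_algebra G l e2)).
Proof.
case: n hn => [|[|m]] // _ mu W1k e2.
have stages := subregular_stages R[i] m.
have e2E := @val_e2 R[i] m.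
split; [exact: stages|split; first exact: (regular_good_grading e2E)].
move=> G l Gg Gl.
have [phi [phi_iso _]] := stages.
apply: (@alg_isomorphic_trans _ _ (U_m2 R[i] m.+2 mu 1 2)); first by exists phi.
apply/alg_isomorphic_sym/(regular_W_algebra_iso e2E Gg Gl) => x.
exact: mem_pyr_m2.
Qed.
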